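(* Let $\{x^k\}_{k\ge 0}$, $\{\mathbf J^k\}_{k\ge 0}$ be the random iterates of the GJS method (defined in the context) with stepsize $\alpha>0$, random projector $\mathcal S$ and unbiased operator $\mathcal U$, applied to $\min_{x} f(x)+\psi(x)$ (problem assumptions in the context). Let $\mathcal B:\mathbb R^{d\times n}\to\mathbb R^{d\times n}$ be any (deterministic) linear operator commuting with $\mathcal S$, and assume that $(\mathcal M^\dagger)^{1/2}$ commutes with $\mathcal S$. Let $\mathcal R:\mathbb R^{d\times n}\to\mathbb R^{d\times n}$ be any linear operator for which $\mathcal R(\mathbf J^k)=\mathcal R(\mathbf G(x^* ))$ for every $k\ge 0$. Define $$\Psi^k=\|x^k-x^*\|^2+\alpha\left\|\mathcal B(\mathcal M^\dagger)^{1/2}\left(\mathbf J^k-\mathbf G(x^* )\right)\right\|^2 .$$ Suppose that $\alpha$ and $\mathcal B$ are such that $$\frac{2\alpha}{n^2}\mathbb E\left[\|(\mathcal U\mathbf X)e\|^2\right]+\left\|(\mathcal I-\mathbb E[\mathcal S])^{1/2}\mathcal B(\mathcal M^\dagger)^{1/2}\mathbf X\right\|^2\le(1-\alpha\sigma)\left\|\mathcal B(\mathcal M^\dagger)^{1/2}\mathbf X\right\|^2$$ for all $\mathbf X\in\mathrm{Range}(\mathcal R^* )^\perp=\mathrm{Null}(\mathcal R)$, and $$\frac{2\alpha}{n^2}\mathbb E\left[\|(\mathcal U\mathbf X)e\|^2\right]+\left\|(\mathbb E[\mathcal S])^{1/2}\mathcal B(\mathcal M^\dagger)^{1/2}\mathbf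 X\right\|^2\le\frac1n\left\|(\mathcal M^\dagger)^{1/2}\mathbf X\right\|^2$$ for all $\mathbf X\in\mathbb R^{d\times n}$. Then for all $k\ge0$, $$\mathbb E[\Psi^k]\le(1-\alpha\sigma)^k\,\Psi^0 .$$
   Context: Problem. $f_1,\dots,f_n:\mathbb R^d\to\mathbb R$ are differentiable and convex, $f=\frac1n\sum_{j=1}^n f_j$, and $\psi:\mathbb R^d\to\mathbb R\cup\{+\infty\}$ is proper, closed and convex. The problem $\min_x f(x)+\psi(x)$ has a unique minimizer $x^*$. The function $f$ is $\sigma$-quasi strongly convex with $\sigma>0$: $f(x^* )\ge f(y)+\langle\nabla f(y),x^*-y\rangle+\frac\sigma2\|y-x^*\|^2$ for all $y\in\mathbb R^d$. Each $f_j$ is $\mathbf M_j$-smooth for a symmetric positive semidefinite $\mathbf M_j\in\mathbb R^{d\times d}$: $f_j(x)\le f_j(y)+\langle\nabla f_j(y),x-y\rangle+\frac12(x-y)^\top\mathbf M_j(x-y)$ for all $x,y$. Notation. $\mathbf G(x)=[\nabla f_1(x),\dots,\nabla f_n(x)]\in\mathbb R^{d\times n}$ is the Jacobian; $e\in\mathbb R^n$ is the all-ones vector; norms are Euclidean for vectors and Frobenius for matrices (with inner product $\mathrm{Tr}(\mathbf X^\top\mathbf Y)$, with respect to which adjoints, $\perp$, square roots of self-adjoint positive semidefinite operators, and pseudoinverses of operators on $\mathbb R^{d\times n}$ are taken). $\mathcal I$ is the identity operator. $\mathcal M$ is the linear operator on $\mathbb R^{d\times n}$ with $(\mathcal M\mathbf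 X)_{:j}=\mathbf M_j\mathbf X_{:j}$ (where $\mathbf X_{:j}$ is the $j$-th column); $\mathcal M^\dagger$ is its Moore–Penrose pseudoinverse. $\mathrm{prox}_{\alpha\psi}(x)=\arg\min_u\{\alpha\psi(u)+\frac12\|u-x\|^2\}$. Random operators. $\mathcal S$ is a random linear operator on $\mathbb R^{d\times n}$ that is always an orthogonal projection ($\mathcal S=\mathcal S^*=\mathcal S^2$); $\mathcal U$ is a random linear operator on $\mathbb R^{d\times n}$ with $\mathbb E[\mathcal U\mathbf X]=\mathbf X$ for all $\mathbf X$. $\mathcal S$ and $\mathcal U$ may be dependent. A deterministic operator commutes with $\mathcal S$ if it commutes with (almost) every realization of $\mathcal S$. GJS method. Start from deterministic $x^0\in\mathbb R^d$, $\mathbf J^0\in\mathbb R^{d\times n}$. At each iteration $k\ge0$ draw a fresh copy $(\mathcal S_k,\mathcal U_k)$ of $(\mathcal S,\mathcal U)$, independent of the past, and set $\mathbf J^{k+1}=\mathbf J^k-\mathcal S_k(\mathbf J^k-\mathbf G(x^k))$, $\;g^k=\frac1n\mathbf J^ke+\frac1n\left(\mathcal U_k(\mathbf G(x^k)-\mathbf J^k)\right)e$, $\;x^{k+1}=\mathrm{prox}_{\alpha\psi}(x^k-\alpha g^k)$. *)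

(* Defs.v *)
From HB Require Import structures.
From mathcomp Require Import all_boot all_order all_algebra.
From mathcomp Require Import all_classical all_reals all_analysis.
Set Implicit Arguments.
Unset Strict Implicit.
Unset Printing Implicit Defensive.
Import Order.TTheory GRing.Theory Num.Theory.
Import numFieldNormedType.Exports.
Local Open Scope classical_set_scope.
Local Open Scope ring_scope.

(* The norm `|X| of the library on matrices is the sup norm, so the Frobenius
   inner product (the Euclidean one on columns) is introduced here. *)
Definition mxdot (R : realType) (m p : nat) (X Y : 'M[R]_(m, p)) : R :=
  \tr (X^T *m Y).

Definition sqnorm (R : realType) (m p : nat) (X : 'M[R]_(m, p)) : R :=
  mxdot X X.

Section Functions.
Variables (R : realType) (d : nat).

Definition grad (f : 'cV[R]_d -> R) (x : 'cV[R]_d) : 'cV[R]_d :=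
  \col_i 'D_(delta_mx i 0) f x.

Definition psd_mx (M : 'M[R]_d) : Prop :=
  M^T = M /\ forall v : 'cV[R]_d, 0 <= mxdot v (M *m v).

Definition smooth_wrt (f : 'cV[R]_d -> R) (M : 'M[R]_d) : Prop :=
  forall x y : 'cV[R]_d,
    f x <= f y + mxdot (grad f y) (x - y) + 2^-1 * mxdot (x - y) (M *m (x - y)).

Definition quasi_strongly_convex (f : 'cV[R]_d -> R) (sigma : R)
    (xs : 'cV[R]_d) : Prop :=
  forall y : 'cV[R]_d,
    f xs >= f y + mxdot (grad f y) (xs - y) + sigma / 2 * sqnorm (y - xs).

Definition proper_fun (psi : 'cV[R]_d -> \bar R) : Prop :=
  (forall x, psi x != -oo%E) /\ (exists x, psi x != +oo%E).

Definition convex_efun (psi : 'cV[R]_d -> \bar R) : Prop :=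
  forall (t : R) (x y : 'cV[R]_d), 0 <= t <= 1 ->
    (psi (t *: x + (1 - t) *: y)%R <= t%:E * psi x + (1 - t)%:E * psi y)%E.

Definition argmin (F : 'cV[R]_d -> \bar R) : set 'cV[R]_d :=
  [set u | forall v, (F u <= F v)%E].

(* The default value 0 is irrelevant when psi is proper, closed and convex and
   alpha > 0: the argmin is then a singleton. *)
Definition prox (alpha : R) (psi : 'cV[R]_d -> \bar R) (x : 'cV[R]_d) :
    'cV[R]_d :=
  xget 0 (argmin (fun u => (alpha%:E * psi u + (2^-1 * sqnorm (u - x))%:E)%E)).

End Functions.

HB.instance Definition _ (R : realType) (aT rT : vectType R) :=
  isPointed.Build 'Hom(aT, rT) 0.

Section Operators.
Variables (R : realType) (d n : nat).
Local Notation op := 'End('M[R]_(d, n)).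

Definition self_adjoint (A : op) : Prop :=
  forall X Y, mxdot (A X) Y = mxdot X (A Y).

Definition orth_proj (A : op) : Prop :=
  self_adjoint A /\ (A \o A)%VF = A.

Definition psd_op (A : op) : Prop :=
  self_adjoint A /\ forall X, 0 <= mxdot (A X) X.

(* For a positive semidefinite A, the unique positive semidefinite B such that
   B B = A. *)
Definition op_sqrt (A : op) : op :=
  xget 0 [set B | psd_op B /\ (B \o B)%VF = A].

Definition is_pinv (A B : op) : Prop :=
  [/\ (A \o B \o A)%VF = A, (B \o A \o B)%VF = B,
      self_adjoint (A \o B)%VF & self_adjoint (B \o A)%VF].

(* The unique solution of the four Penrose equations. *)
Definition op_pinv (A : op) : op := xget 0 [set B | is_pinv A B].

(* (calM X)_{:j} = M_j X_{:j} *)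
Definition smoothness_op (M : 'I_n -> 'M[R]_d) : op :=
  linfun (fun X : 'M[R]_(d, n) => \matrix_(i, j) (M j *m col j X) i 0).

Definition pinv_sqrt (M : 'I_n -> 'M[R]_d) : op :=
  op_sqrt (op_pinv (smoothness_op M)).

(* The sigma-algebra on operators generated by the maps A |-> (A X)_{ij}, i.e.
   the Borel sigma-algebra of this finite-dimensional space. *)
Definition op_cylinders : set (set op) :=
  [set C | exists (X : 'M[R]_(d, n)) (i : 'I_d) (j : 'I_n) (B : set R),
     measurable B /\ C = [set A : op | B (A X i j)]].

Definition opType := g_sigma_algebraType op_cylinders.

End Operators.

Section RandomOperators.
Variables (R : realType) (d n : nat).
Local Notation op := 'End('M[R]_(d, n)).
Variables (disp : measure_display) (T : measurableType disp).

Definition random_op (A : T -> op) : Prop :=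
  measurable_fun [set: T] (A : T -> opType R d n).

Variable P : probability T R.

Definition unbiased (U : T -> op) : Prop :=
  forall (X : 'M[R]_(d, n)) (i : 'I_d) (j : 'I_n),
    P.-integrable [set: T] (fun w => (U w X i j)%:E) /\
    ('E_P[fun w => U w X i j] = (X i j)%:E)%E.

(* linfun only retains the values on a basis; for integrable A the function
   below is linear, so that op_mean A X = E[A X]. *)
Definition op_mean (A : T -> op) : op :=
  linfun (fun X : 'M[R]_(d, n) =>
    \matrix_(i, j) fine ('E_P[fun w => A w X i j])%E).

Definition commutes_with (A : op) (S : T -> op) : Prop :=
  {ae P, forall w, (A \o S w)%VF = (S w \o A)%VF}.

Definition pair_events (A B : T -> op) : set (set T) :=
  preimage_set_system [set: T]
    (fun w => (A w, B w) : opType R d n * opType R d n) measurable.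

Definition past_events (A B : nat -> T -> op) (k : nat) : set (set T) :=
  <<s \bigcup_(i in [set i | (i < k)%N]) pair_events (A i) (B i) >>.

Definition independent_of_past (A B : nat -> T -> op) : Prop :=
  forall k (E F : set T), past_events A B k E -> pair_events (A k) (B k) F ->
    (P (E `&` F) = P E * P F)%E.

End RandomOperators.

Definition same_law (R : realType) (d n : nat)
    (disp disp' : measure_display)
    (T : measurableType disp) (P : probability T R)
    (T' : measurableType disp') (P' : probability T' R)
    (A B : T -> 'End('M[R]_(d, n))) (A' B' : T' -> 'End('M[R]_(d, n))) : Prop :=
  forall C : set (opType R d n * opType R d n), measurable C ->
    P [set w | C (A w, B w)] = P' [set w | C (A' w, B' w)].

Section GJS.
Variables (R : realType) (d n : nat).
Local Notation op := 'End('M[R]_(d, n)).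

Definition avg_fun (fs : 'I_n -> 'cV[R]_d -> R) (x : 'cV[R]_d) : R :=
  n%:R^-1 * \sum_(j < n) fs j x.

Definition jac (fs : 'I_n -> 'cV[R]_d -> R) (x : 'cV[R]_d) : 'M[R]_(d, n) :=
  \matrix_(i, j) grad (fs j) x i 0.

Definition ones : 'cV[R]_n := const_mx 1.

(* S and U are the realizations of the operators drawn at each iteration; the
   result is the pair (x^k, J^k). *)
Fixpoint gjs (alpha : R) (psi : 'cV[R]_d -> \bar R)
    (fs : 'I_n -> 'cV[R]_d -> R) (x0 : 'cV[R]_d) (J0 : 'M[R]_(d, n))
    (S U : nat -> op) (k : nat) : 'cV[R]_d * 'M[R]_(d, n) :=
  if k is k'.+1 then
    let: (x, J) := gjs alpha psi fs x0 J0 S U k' in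
    let g := n%:R^-1 *: (J *m ones) +
             n%:R^-1 *: (U k' (jac fs x - J) *m ones) in
    (prox alpha psi (x - alpha *: g), J - S k' (J - jac fs x))
  else (x0, J0).

Definition lyapunov (alpha : R) (B : op) (M : 'I_n -> 'M[R]_d)
    (xs : 'cV[R]_d) (Gs : 'M[R]_(d, n)) (z : 'cV[R]_d * 'M[R]_(d, n)) : R :=
  sqnorm (z.1 - xs) + alpha * sqnorm (B (pinv_sqrt M (z.2 - Gs))).

End GJS.

(* Main.v *)
Require Import Defs.
From HB Require Import structures.
From mathcomp Require Import all_boot all_order all_algebra.
From mathcomp Require Import all_classical all_reals all_analysis.
From mathcomp Require Import measurable_realfun complex spectral ring lra.
Set Implicit Arguments.
Unset Strict Implicit.
Unset Printing Implicit Defensive.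
Import Order.TTheory GRing.Theory Num.Theory.
Import numFieldNormedType.Exports.
Local Open Scope classical_set_scope.
Local Open Scope ring_scope.

(** Write [G = jac fs], [Y = J^k - G x*], [D = G x^k - G x*] and
    [Q = B (M^+)^(1/2)]. Since [Q] commutes with the projection [S], the Jacobian
    part of the Lyapunov function splits as
    [|Q (J^(k+1) - G x* )|^2 = <(I - S) Q Y, Q Y> + <S Q D, Q D>]. The prox is
    nonexpansive and fixes [x*] up to the gradient step, and
    [g^k - grad f(x* ) = n^-1 (Y e - (U Y) e + (U D) e)], whose second moment is at
    most [2 n^-2 (E|(U Y) e|^2 + E|(U D) e|^2)]. The two hypotheses absorb the terms
    in [Y] and in [D]; what remains of the latter, [n^-1 |(M^+)^(1/2) D|^2], is at
    most twice the Bregman divergence [f x - f x* - <grad f x*, x - x*>], which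
    quasi strong convexity of [f] cancels. This bounds the expected Lyapunov function
    after one step from a fixed state; as the fresh operators are independent of the
    past, Fubini's theorem extends the bound to the random iterates. *)

(** * Frobenius product and operator square roots *)

Section FrobeniusProduct.
Variables (R : realType) (m p : nat).
Implicit Types (X Y Z : 'M[R]_(m, p)) (a : R).

Lemma mxdotE X Y : mxdot X Y = \sum_i \sum_j X i j * Y i j.
Proof.
rewrite /mxdot /mxtrace exchange_big /=; apply: eq_bigr => j _.
by rewrite mxE; apply: eq_bigr => i _; rewrite mxE.
Qed.

Lemma mxdotC X Y : mxdot X Y = mxdot Y X.
Proof. by rewrite !mxdotE; do 2! apply: eq_bigr => ? _; rewrite mulrC. Qed.

Lemma mxdotDl X Y Z : mxdot (X + Y) Z = mxdot X Z + mxdot Y Z.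
Proof. by rewrite /mxdot linearD /= mulmxDl linearD. Qed.

Lemma mxdotZl a X Y : mxdot (a *: X) Y = a * mxdot X Y.
Proof. by rewrite /mxdot linearZ /= -scalemxAl linearZ. Qed.

Lemma mxdotNl X Y : mxdot (- X) Y = - mxdot X Y.
Proof. by rewrite -scaleN1r mxdotZl mulN1r. Qed.

Lemma mxdotBl X Y Z : mxdot (X - Y) Z = mxdot X Z - mxdot Y Z.
Proof. by rewrite mxdotDl mxdotNl. Qed.

Lemma mxdotDr X Y Z : mxdot Z (X + Y) = mxdot Z X + mxdot Z Y.
Proof. by rewrite mxdotC mxdotDl !(mxdotC Z). Qed.

Lemma mxdotZr a X Y : mxdot Y (a *: X) = a * mxdot Y X.
Proof. by rewrite mxdotC mxdotZl (mxdotC Y). Qed.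

Lemma mxdotNr X Y : mxdot Y (- X) = - mxdot Y X.
Proof. by rewrite mxdotC mxdotNl (mxdotC Y). Qed.

Lemma mxdotBr X Y Z : mxdot Z (X - Y) = mxdot Z X - mxdot Z Y.
Proof. by rewrite mxdotDr mxdotNr. Qed.

Lemma mxdot0l X : mxdot 0 X = 0.
Proof. by rewrite /mxdot trmx0 mul0mx mxtrace0. Qed.

Lemma mxdot0r X : mxdot X 0 = 0.
Proof. by rewrite mxdotC mxdot0l. Qed.

Definition mxdot_linear := (mxdotDl, mxdotDr, mxdotBl, mxdotBr, mxdotNl,
  mxdotNr, mxdotZl, mxdotZr).

Lemma sqnormE X : sqnorm X = \sum_i \sum_j X i j ^+ 2.
Proof. by rewrite /sqnorm mxdotE; do 2! apply: eq_bigr => ? _. Qed.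

Lemma sqnorm_ge0 X : 0 <= sqnorm X.
Proof. by rewrite sqnormE; do 2! apply: sumr_ge0 => ? _; apply: sqr_ge0. Qed.

Lemma sqnorm0 : sqnorm (0 : 'M[R]_(m, p)) = 0.
Proof. exact: mxdot0l. Qed.

Lemma sqnormZ a X : sqnorm (a *: X) = a ^+ 2 * sqnorm X.
Proof. by rewrite /sqnorm !mxdot_linear mulrA. Qed.

Lemma sqnormN X : sqnorm (- X) = sqnorm X.
Proof. by rewrite /sqnorm !mxdot_linear opprK. Qed.

Lemma sqnormD X Y : sqnorm (X + Y) = sqnorm X + 2 * mxdot X Y + sqnorm Y.
Proof. by rewrite /sqnorm !mxdot_linear (mxdotC Y X); lra. Qed.

Lemma sqnormB X Y : sqnorm (X - Y) = sqnorm X - 2 * mxdot X Y + sqnorm Y.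
Proof. by rewrite sqnormD mxdotNr sqnormN; lra. Qed.

Lemma sqnormD_le2 X Y : sqnorm (X + Y) <= 2 * sqnorm X + 2 * sqnorm Y.
Proof. by have := sqnorm_ge0 (X - Y); rewrite sqnormB sqnormD; lra. Qed.

Lemma mxdot_le2 X Y : 2 * mxdot X Y <= sqnorm X + sqnorm Y.
Proof. by have := sqnorm_ge0 (X - Y); rewrite sqnormB; lra. Qed.

Lemma coord_le_sqnorm X i j : X i j ^+ 2 <= sqnorm X.
Proof.
rewrite sqnormE (bigD1 i) //= (bigD1 j) //= -addrA lerDl addr_ge0 //.
  by apply: sumr_ge0 => ? _; apply: sqr_ge0.
by do 2! apply: sumr_ge0 => ? _; apply: sqr_ge0.
Qed.

(** Flattening is an isometry, so a square root found for matrices can serve for operators. *)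
Lemma mxdot_mxvec X Y : mxdot X Y = (mxvec X *m (mxvec Y)^T) 0 0.
Proof.
rewrite mxdotE pair_bigA mxE /= (reindex (uncurry (@mxvec_index m p))) /=.
  by apply: eq_bigr => -[i j] _ /=; rewrite mxE !mxvecE.
by exact: (subon_bij (fun _ _ => isT) (curry_mxvec_bij m p)).
Qed.

End FrobeniusProduct.

Section PolynomialInterpolation.

Lemma interpolation (F : fieldType) (s : seq F) (f : F -> F) :
  exists q : {poly F}, {in s, forall x, q.[x] = f x}.
Proof.
elim: s => [|y s [q qs]]; first by exists 0.
have [ys|ys] := boolP (y \in s).
  by exists q => x; rewrite inE => /orP[/eqP ->|]; apply: qs.
(* [r] vanishes exactly on [s], so a multiple of it corrects the value at [y] without disturbing the
   earlier nodes. *)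
pose r := \prod_(z <- s) ('X - z%:P).
have rE x : (r.[x] == 0) = (x \in s) by rewrite -[LHS]/(root r x) root_prod_XsubC.
exists (q + ((f y - q.[y]) / r.[y])%:P * r) => x.
rewrite !hornerE inE => /orP[/eqP ->|xs].
  by rewrite divfK ?rE // addrC subrK.
by have := xs; rewrite -rE => /eqP ->; rewrite mulr0 addr0 qs.
Qed.

End PolynomialInterpolation.

Section SymmetricSqrt.
Variable R : realType.

Lemma trmx_horner_mx N (A : 'M[R]_N.+1) (q : {poly R}) :
  (horner_mx A q)^T = horner_mx A^T q.
Proof.
elim/poly_ind: q => [|q c IH]; first by rewrite !rmorph0 trmx0.
rewrite !rmorphD !rmorphM /= !horner_mx_X !horner_mx_C linearD /= tr_scalar_mx.
congr (_ + _); rewrite -!mulmxE trmx_mul IH.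
exact: comm_mx_horner.
Qed.

(* A real symmetric matrix is diagonalizable with real spectrum, so polynomials
   taking the same values on the spectrum have the same value at the matrix;
   the square root is q(A)^2 for a q interpolating the fourth root. *)
Lemma psd_mx_sqrt N (A : 'M[R]_N) : A^T = A ->
  (forall v : 'rV[R]_N, 0 <= (v *m A *m v^T) 0 0) ->
  exists H : 'M[R]_N, H^T = H /\ H *m H *m (H *m H) = A.
Proof.
(* Size 0 is treated apart because [horner_mx] needs a successor size. *)
case: N A => [|N] A symA psdA.
  by exists 0; split; apply/matrixP => -[].
pose toC := real_complex R.
pose Ac := map_mx toC A.
have Ac_herm : Ac \is hermsymmx.
  apply: realsym_hermsym.
    apply/is_hermitianmxP; rewrite expr0 scale1r map_mx_id // map_trmx.
    by rewrite symA.
  by apply/mxOverP => i j; rewrite mxE complex_real.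
have /orthomx_spectralP AE := hermitian_normalmx Ac_herm.
set P := spectralmx Ac in AE; set D := spectral_diag Ac in AE.
have Pu : P \in unitmx by exact: spectral_unit.
have D_real i : exists2 l : R, 0 <= l & D 0 i = toC l.
  have /mxOverP/(_ 0 i) := hermitian_spectral_diag_real Ac_herm.
  rewrite -/D => /complex_realP [l Dl]; exists l => //.
  have : eigenvalue Ac (toC l).
    apply/eigenvalueP; exists (row i P).
      rewrite {1}AE -!row_mul !mulmxA mulmxV // mul1mx row_mul row_diag_mx.
      by rewrite -scalemxAl -rowE Dl.
    apply: contraTneq Pu => P0; rewrite -row_free_unit; apply/negP.
    move=> /row_free_inj/(_ (delta_mx 0 i : 'rV_N.+1) 0) /=.
    rewrite -rowE P0 mul0mx => /(_ erefl)/rowP/(_ i)/eqP.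
    by rewrite !mxE !eqxx oner_eq0.
  (* The characteristic polynomial brings the eigenvalue back to the real matrix [A], where a real
     eigenvector can be fed to [psdA]. *)
  rewrite eigenvalue_root_char -map_char_poly fmorph_root.
  rewrite -eigenvalue_root_char => /eigenvalueP [v vA v0].
  have := psdA v; rewrite vA -scalemxAl mxE.
  have vv : 0 < (v *m v^T) 0 0.
    rewrite lt_def; apply/andP; split; last first.
      by rewrite mxE; apply: sumr_ge0 => j _; rewrite mxE -expr2 sqr_ge0.
    apply: contra v0; rewrite mxE psumr_eq0; last first.
      by move=> j _; rewrite mxE -expr2 sqr_ge0.
    move=> /allP vj; apply/eqP/rowP => j; rewrite mxE.
    have := vj j (mem_index_enum _); rewrite mxE -expr2 sqrf_eq0.
    by move/eqP.
  by rewrite pmulr_lge0.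
pose l i := s2val (cid2 (D_real i)).
have l_ge0 i : 0 <= l i by rewrite /l; case: cid2.
have DE i : D 0 i = toC (l i) by rewrite /l; case: cid2.
have [q qE] := interpolation [seq l i | i <- enum 'I_N.+1]
  (fun x => Num.sqrt (Num.sqrt x)).
exists (horner_mx A q); split.
  by rewrite trmx_horner_mx symA.
rewrite mulmxE -!rmorphM /=.
apply: (@map_mx_inj _ _ toC).
rewrite map_horner_mx -[map_mx toC A]/Ac AE (horner_mx_uconjC _ _ Pu).
congr (_ *m _ *m _); rewrite horner_mx_diag; congr diag_mx.
apply/rowP => i; rewrite mxE DE horner_map !hornerM qE ?map_f ?mem_enum //.
by congr toC; rewrite -!expr2 !sqr_sqrtr ?sqrtr_ge0.
Qed.

End SymmetricSqrt.

Section OperatorSqrt.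
Variables (R : realType) (d n : nat).
Local Notation op := 'End('M[R]_(d, n)).
Implicit Types (A B : op) (X Y : 'M[R]_(d, n)).

Lemma psd_op_sqrt_ex A : psd_op A -> exists B, psd_op B /\ (B \o B)%VF = A.
Proof.
move=> [selfA posA]; pose L := lin_mx A.
have LE X : mxvec X *m L = mxvec (A X) by rewrite mul_vec_lin.
have Lsym : L^T = L.
  apply/matrixP => i j.
  have := selfA (vec_mx (delta_mx 0 j)) (vec_mx (delta_mx 0 i)).
  rewrite !mxdot_mxvec -!LE !vec_mxK trmx_mul !mulmxA -!rowE !trmx_delta.
  by rewrite -!colE !mxE => ->.
have [H [Hsym HE]] : exists H, H^T = H /\ H *m H *m (H *m H) = L.
  apply: psd_mx_sqrt => // v.
  by have := posA (vec_mx v); rewrite mxdot_mxvec -LE !vec_mxK.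
pose h : op := linfun (vec_mx \o (mulmxr H \o mxvec)).
have hE X : h X = vec_mx (mxvec X *m H) by rewrite lfunE.
have self_h X Y : mxdot (h X) Y = mxdot X (h Y).
  by rewrite !mxdot_mxvec !hE !vec_mxK trmx_mul Hsym mulmxA.
(* As the square of a self-adjoint [h], the root is positive at once: its quadratic form is
   [sqnorm (h X)]. *)
exists (h \o h)%VF; split; last first.
  apply/lfunP => X; rewrite !comp_lfunE !hE !vec_mxK -!mulmxA.
  by rewrite [H *m (H *m _)]mulmxA HE LE mxvecK.
split=> [X Y|X]; rewrite !comp_lfunE self_h; last exact: sqnorm_ge0.
by rewrite self_h.
Qed.

(** Whatever root [xget] picks, it is self-adjoint and squares to [A], which fixes this norm. The
    square roots in the two hypotheses thus become quadratic forms. *)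
Lemma sqnorm_op_sqrt A X : psd_op A -> sqnorm (op_sqrt A X) = mxdot (A X) X.
Proof.
move=> /psd_op_sqrt_ex/(xgetPex 0) [[+ _]]; rewrite -/(op_sqrt A).
by move: (op_sqrt A) => B selfB <-; rewrite comp_lfunE selfB.
Qed.

(* The first case is the junk value, when [A] has no square root. *)
Lemma op_sqrtP A : op_sqrt A = 0 \/
  self_adjoint A /\ forall X, sqnorm (op_sqrt A X) = mxdot (A X) X.
Proof.
have [/(xgetPex 0)[[+ _]]|noB] :=
    pselect (exists B, [set B | psd_op B /\ (B \o B)%VF = A] B).
  rewrite -/(op_sqrt A); move: (op_sqrt A) => B selfB <-; right.
  by split=> [X Y|X]; rewrite !comp_lfunE selfB // selfB.
by left; rewrite /op_sqrt xgetPN // => B BP; apply: noB; exists B.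
Qed.

Lemma op_pinvP A : op_pinv A = 0 \/ is_pinv A (op_pinv A).
Proof. by rewrite /op_pinv; case: xgetP => [B ->|]; [right|left]. Qed.

End OperatorSqrt.

(** * Convex smooth functions *)

Section SmoothConvex.
Variables (R : realType) (d : nat).
Implicit Types (f h : 'cV[R]_d -> R) (x y z u v w p g : 'cV[R]_d).

(** Replaces the passage to the limit [t -> 0] in first-order arguments. *)
Lemma affine_ge0_at0 (a b : R) : (forall t : R, 0 < t <= 1 -> 0 <= a + t * b) ->
  0 <= a.
Proof.
move=> ab; rewrite leNgt; apply/negP => a0.
(* Small enough that [t * b] is at most [- a / 2], so [a + t * b] stays negative. *)
pose t := Num.min 1 (- a / (2 * (`|b| + 1))).
have b1 : 0 < `|b| + 1 by rewrite ltr_wpDl.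
have t0 : 0 < t by rewrite lt_min ltr01 divr_gt0 ?oppr_gt0 ?mulr_gt0.
have t1 : t <= 1 by rewrite ge_min lexx.
have tb : t * (`|b| + 1) <= - a / 2.
  by rewrite -ler_pdivlMr // -mulrA -invfM ge_min lexx orbT.
have := ab t; rewrite t0 t1 => /(_ isT).
have : t * b <= t * (`|b| + 1).
  by rewrite ler_pM2l // (le_trans (ler_norm b)) // lerDl.
by move: tb a0; lra.
Qed.

Lemma convex_functionE f : convex_function [set: 'cV[R]_d] f ->
  forall (t : R) x y, 0 <= t <= 1 ->
  f (t *: x + (1 - t) *: y) <= t * f x + (1 - t) * f y.
Proof.
move=> cf t x y /andP[t0 t1].
by have := cf (Itv01 t0 t1) x y; rewrite !inE; apply.
Qed.

(* Convexity bounds [f y] by the values at [z] and at [y - s (z - y)], where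
   smoothness applies; then [s] tends to 0. *)
Lemma convex_smooth_gradient_le f (M : 'M[R]_d) y z :
  convex_function [set: 'cV[R]_d] f -> smooth_wrt f M ->
  f y + mxdot (grad f y) (z - y) <= f z.
Proof.
move=> /convex_functionE cf sf; rewrite -subr_ge0.
apply: (@affine_ge0_at0 _ (2^-1 * mxdot (z - y) (M *m (z - y)))).
move=> s /andP[s0 s1].
have s1p : 0 < 1 + s by rewrite addr_gt0.
have t01 : 0 <= s / (1 + s) <= 1.
  by rewrite divr_ge0 ?(ltW s0) ?(ltW s1p) //= ler_pdivrMr // mul1r lerDr.
have := cf _ z (y - s *: (z - y)) t01.
have -> : 1 - s / (1 + s) = (1 + s)^-1 by field; rewrite gt_eqF.
have -> : (s / (1 + s)) *: z + (1 + s)^-1 *: (y - s *: (z - y)) = y.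
  apply/matrixP => i j; rewrite !mxE; field; rewrite gt_eqF //.
have := sf (y - s *: (z - y)) y.
have -> : y - s *: (z - y) - y = - s *: (z - y).
  by rewrite addrAC subrr add0r scaleNr.
rewrite -scalemxAr !(mxdotZl, mxdotZr).
set A := mxdot _ _; set Q := mxdot _ (M *m _).
set fs := f (y - _) => fsle.
rewrite mulrAC [_^-1 * fs]mulrC -mulrDl ler_pdivlMr // => fyle.
suff : 0 <= s * (f z - (f y + A) + s * (2^-1 * Q)) by rewrite pmulr_rge0.
by move: fsle fyle; lra.
Qed.

(** At the test point [x - w], [f] lies above its tangent at [y] and below the smoothness parabola
    at [x]. Keeping [w] free allows both a Lipschitz bound and the pseudoinverse bound to be read
    off later. *)
Lemma convex_smooth_gap f (M : 'M[R]_d) x y w :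
  convex_function [set: 'cV[R]_d] f -> smooth_wrt f M ->
  mxdot (grad f x - grad f y) w - 2^-1 * mxdot w (M *m w)
  <= f x - f y - mxdot (grad f y) (x - y).
Proof.
move=> cf sf.
have := convex_smooth_gradient_le y (x - w) cf sf; have := sf (x - w) x.
have -> : x - w - x = - w by rewrite addrAC subrr add0r.
have -> : x - w - y = (x - y) - w by rewrite addrAC.
rewrite mulmxN !mxdotNl !mxdotNr opprK !mxdotBl (mxdotBr _ w).
by lra.
Qed.

Lemma mxdot_mulmx_bound (M : 'M[R]_d) :
  exists2 L : R, 0 < L & forall v, mxdot v (M *m v) <= L * sqnorm v.
Proof.
(* The added 1 keeps the constant positive when [M] is zero, since it gets inverted. *)
exists (1 + \sum_i \sum_j `|M i j|) => [|v].
  by rewrite ltr_wpDr // sumr_ge0 // => i _; rewrite sumr_ge0.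
rewrite mxdotE mulrDl mul1r ler_wpDl ?sqnorm_ge0 // mulr_suml.
apply: ler_sum => i _; rewrite big_ord1 mxE mulr_sumr mulr_suml.
apply: ler_sum => j _.
have -> : v i 0 * (M i j * v j 0) = M i j * (v i 0 * v j 0) by ring.
rewrite (le_trans (ler_norm _)) // normrM ler_wpM2l // ler_norml.
have := coord_le_sqnorm v i 0; have := coord_le_sqnorm v j 0.
have := sqr_ge0 (v i 0 - v j 0); have := sqr_ge0 (v i 0 + v j 0).
by move=> *; apply/andP; split; nra.
Qed.

(** Take [w = L^-1 *: (grad f x - grad f y)] in [convex_smooth_gap] and bound the gap above by
    smoothness. This serves the measurability of the iterates. *)
Lemma grad_lipschitz f (M : 'M[R]_d) :
  convex_function [set: 'cV[R]_d] f -> smooth_wrt f M ->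
  exists2 L : R, 0 < L &
    forall x y, sqnorm (grad f x - grad f y) <= L * sqnorm (x - y).
Proof.
move=> cf sf; have [L L0 ML] := mxdot_mulmx_bound M.
exists (L ^+ 2) => [|x y]; first by rewrite exprn_gt0.
have := convex_smooth_gap x y (L^-1 *: (grad f x - grad f y)) cf sf.
set v := grad f x - grad f y.
have := ML v; have := sf x y; have := ML (x - y).
rewrite -scalemxAr !(mxdotZl, mxdotZr) -/(sqnorm v) => h1 h2 h3 h4.
have h5 : L^-1 * sqnorm v - 2^-1 * (L^-1 * (L^-1 * (L * sqnorm v)))
          <= 2^-1 * (L * sqnorm (x - y)).
  have : L^-1 * (L^-1 * mxdot v (M *m v)) <= L^-1 * (L^-1 * (L * sqnorm v)).
    by rewrite !ler_pM2l ?invr_gt0.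
  by move: h1 h2 h4; lra.
have h6 : L^-1 * sqnorm v <= L * sqnorm (x - y).
  by move: h5; rewrite (mulKf (lt0r_neq0 L0)); lra.
by rewrite expr2 -mulrA -ler_pdivrMl.
Qed.

End SmoothConvex.

(** * Proximal operator *)

Section Prox.
Variables (R : realType) (d : nat).
Implicit Types (phi psi : 'cV[R]_d -> \bar R) (h : 'cV[R]_d -> R).
Implicit Types (a b x y z u v p q g : 'cV[R]_d).

(** The inequality is asked only where [phi] is finite, so that it lives in [R]. *)
Definition subgradient phi p g : Prop :=
  phi p \is a fin_num /\
  forall u r, phi u = r%:E -> fine (phi p) + mxdot g (u - p) <= r.

(** Fermat's rule, with a quadratic upper bound in place of differentiability: compare [p] with
    [t *: u + (1 - t) *: p], divide by [t] and let [t] tend to 0. It is applied to [f] at [xs] and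
    to the quadratic term of the prox. *)
Lemma argmin_subgradient phi h p g (C : R) :
  proper_fun phi -> convex_efun phi ->
  (forall u, h u <= h p + mxdot g (u - p) + C * sqnorm (u - p)) ->
  argmin (fun u => (h u)%:E + phi u)%E p ->
  subgradient phi p (- g).
Proof.
move=> [phiNy [w phiw]] cphi smooth minp.
have finp : phi p \is a fin_num.
  rewrite fin_numE phiNy /=; apply/eqP => py.
  have := minp w; rewrite /= py addey // leye_eq.
  by move: (phiNy w) phiw; case: (phi w).
split => // u r ur; rewrite -subr_ge0.
apply: (@affine_ge0_at0 _ _ (C * sqnorm (u - p))) => t /andP[t0 t1].
have := cphi t u p; rewrite (ltW t0) t1 => /(_ isT).
have := minp (t *: u + (1 - t) *: p); have := smooth (t *: u + (1 - t) *: p).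
have -> : t *: u + (1 - t) *: p - p = t *: (u - p).
  by apply/matrixP => i j; rewrite !mxE; ring.
rewrite sqnormZ mxdotNl mxdotZr ur -(fineK finp).
move: (phi _) (phiNy (t *: u + (1 - t) *: p)) => -[s||] //= _.
rewrite !lee_fin => h1 h2 h3.
rewrite -(pmulr_rge0 _ t0); move: h1 h2 h3; lra.
Qed.

Lemma subgradient_monotone phi p q a b :
  subgradient phi p a -> subgradient phi q b -> 0 <= mxdot (a - b) (p - q).
Proof.
move=> [finp subp] [finq subq].
have := subp q _ (esym (fineK finq)); have := subq p _ (esym (fineK finp)).
by rewrite -[q - p]opprB mxdotNr mxdotBl; lra.
Qed.

(** Monotonicity bounds [sqnorm (p - q)] by [mxdot (a - b) (p - q)]; the residuals are the
    subgradients that the prox produces. *)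
Lemma subgradient_nonexpansive phi a b p q :
  subgradient phi p (a - p) -> subgradient phi q (b - q) ->
  sqnorm (p - q) <= sqnorm (a - b).
Proof.
move=> sp sq; have := subgradient_monotone sp sq.
have -> : a - p - (b - q) = (a - b) - (p - q).
  by apply/matrixP => i j; rewrite !mxE; ring.
rewrite mxdotBl -/(sqnorm (p - q)).
by have := mxdot_le2 (a - b) (p - q); lra.
Qed.

Lemma near_sqnorm_lt (u_ : nat -> 'cV[R]_d) (l : 'cV[R]_d) : u_ @ \oo --> l ->
  forall e : R, 0 < e -> \forall k \near \oo, sqnorm (u_ k - l) <= e.
Proof.
move=> ul e e0.
(* The topology is that of the sup norm: [r <= 1] gives [r ^+ 2 <= r], and [d] entries then
   contribute at most [d%:R * r <= e]. *)
pose r := Num.min 1 (e / (d%:R + 1)).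
have d1 : (0 : R) < d%:R + 1 by rewrite ltr_wpDl.
have r0 : 0 < r by rewrite lt_min ltr01 divr_gt0.
have /cvg_ball/(_ r r0) := ul.
apply: filterS => k [_ /= lk].
rewrite sqnormE (@le_trans _ _ (\sum_(i < d) r)) //.
  apply: ler_sum => i _; rewrite big_ord1 !mxE.
  have := lk i 0; rewrite -ball_normE /= distrC => /ltW lkr.
  rewrite -real_normK ?num_real // expr2.
  rewrite -[leRHS]mulr1 ler_pM //.
  by rewrite (le_trans lkr) // ge_min lexx.
rewrite sumr_const card_ord -mulr_natl.
have : r <= e / (d%:R + 1) by rewrite ge_min lexx orbT.
rewrite ler_pdivlMr // mulrDr mulr1 mulrC => rd.
by rewrite (le_trans _ rd) // lerDl ltW.
Qed.

(** Direct method: the affine minorant makes the infimum finite, strong convexity makes a minimizing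
    sequence Cauchy, and lower semicontinuity makes its limit a minimizer. *)
Lemma prox_argmin_ex phi p g (c : R) x :
  proper_fun phi -> convex_efun phi -> lower_semicontinuous phi ->
  (forall u, (c + mxdot g (u - p))%:E <= phi u)%E ->
  exists l, argmin (fun u => phi u + (2^-1 * sqnorm (u - x))%:E)%E l.
Proof.
move=> [phiNy [w phiw]] cphi lsc minorant.
have [rw phirw] : exists r, phi w = r%:E.
  by move: (phiNy w) phiw; case: (phi w) => [r||] // _ _; exists r.
(* [F u r] says that the objective at [u] is finite and at most [r], so that the infimum can be
   taken in [R]. *)
pose F u (r : R) := exists2 s, phi u = s%:E & s + 2^-1 * sqnorm (u - x) <= r.
pose D : set R := [set r | exists u, F u r].
have lbD : has_inf D.
  split; first by exists (rw + 2^-1 * sqnorm (w - x)), w, rw.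
  (* The minimum of the minorant plus the quadratic term, reached at [u - x = - g]. *)
  exists (c + mxdot g (x - p) - 2^-1 * sqnorm g) => r [u [s us]].
  have := minorant u; rewrite us lee_fin.
  have -> : u - p = (u - x) + (x - p).
    by apply/matrixP => i j; rewrite !mxE; ring.
  rewrite mxdotDr; have := mxdot_le2 (- g) (u - x).
  by rewrite mxdotNl sqnormN; lra.
pose m := inf D.
have mF u r : F u r -> m <= r by move=> Fur; apply: inf_lbound; [exact: lbD.2|exists u].
pose eps (k : nat) : R := k.+1%:R^-1.
have /choice[u_ u_P] k : exists u, F u (m + eps k).
  have k0 : 0 < eps k by rewrite /eps invr_gt0.
  have [r [u Fur] rm] := inf_adherent k0 lbD.
  by exists u; case: Fur => s us sr; exists s => //; rewrite (le_trans sr) ?ltW.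
(* The midpoint has value at least [m]; convexity of [phi] and the parallelogram identity turn this
   into a distance bound. *)
have F_close u v e : F u (m + e) -> F v (m + e) -> sqnorm (u - v) <= 8 * e.
  move=> [s us se] [t vt te].
  have := cphi 2^-1 u v; rewrite us vt; set y := _ + _ *: v.
  have h2 : 0 <= (2^-1 : R) <= 1 by apply/andP; split; lra.
  move=> /(_ h2); move: (phiNy y) (@mF y); rewrite /F; case: (phi y) => [r||] // _ my.
  rewrite !lee_fin => rst.
  have := my _ (ex_intro2 _ _ r erefl (lexx _)).
  have -> : y - x = 2^-1 *: ((u - x) + (v - x)).
    by apply/matrixP => i j; rewrite !mxE; field.
  have -> : u - v = (u - x) - (v - x).
    by apply/matrixP => i j; rewrite !mxE; ring.
  move: se te rst; move: (u - x) (v - x) => a b.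
  by rewrite sqnormZ sqnormD sqnormB; lra.
have inv_le k K : (K <= k)%N -> eps k <= eps K .
  by move=> Kk; rewrite /eps lef_pV2 ?posrE // ler_nat.
have F_mono u r s : F u r -> r <= s -> F u s.
  by move=> [t ut tr] rs; exists t => //; rewrite (le_trans tr).
have inv_small (e : R) : 0 < e -> exists K : nat, eps K <= e.
  move=> e0; exists (Num.trunc e^-1).
  by rewrite /eps invf_ple ?posrE // ltW // truncnS_gt.
have u_cvg : cvg (u_ @ \oo).
  apply/cauchy_cvgP/cauchy_exP => e e0.
  (* With this accuracy [F_close] gives [e ^+ 2 / 2], strictly below [e ^+ 2]. *)
  have e16 : 0 < e ^+ 2 / 16 by rewrite divr_gt0 // exprn_gt0.
  have [K Ke] := inv_small _ e16.
  exists (u_ K); exists K => // k /= Kk; split => // i j.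
  rewrite -ball_normE /=.
  have := coord_le_sqnorm (u_ K - u_ k) i j; rewrite !mxE.
  have : sqnorm (u_ K - u_ k) <= 8 * eps K.
    apply: F_close => //; apply: F_mono (u_P k) _.
    by rewrite lerD2l inv_le.
  rewrite -real_normK ?num_real // => h1 h2.
  rewrite -(ltr_pXn2r (_ : 0 < 2)%N) ?nnegrE //; last exact: ltW.
  apply: (le_lt_trans h2); apply: (le_lt_trans h1).
  apply: le_lt_trans (ler_wpM2l _ Ke) _ => //.
  have e20 : 0 < e ^+ 2 by rewrite exprn_gt0.
  by lra.
pose l := lim (u_ @ \oo); have ul : u_ @ \oo --> l by [].
(* Working with any real [r] below [phi l] covers the case [phi l = +oo], which is later refuted by
   taking [r] too large. *)
have key r : (r%:E < phi l)%E -> r + 2^-1 * sqnorm (l - x) <= m.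
  move=> rl; rewrite -subr_ge0; apply: (@affine_ge0_at0 _ _ 
     (1 + 2^-1 * (1 + sqnorm (l - x)))) => e /andP[e0 e1].
  have [V Vl Vphi] := lsc _ _ rl.
  have [K Ke] := inv_small e e0.
  have e20 : 0 < e ^+ 2 by rewrite exprn_gt0.
  near \oo => k.
  have [s uks sm] := u_P k.
  have : (r%:E < phi (u_ k))%E.
    apply: Vphi. near: k. exact: ul.
  rewrite uks lte_fin => rs.
  (* A squared distance of order [e ^+ 2] leaves a cross term of order [e]. *)
  have ukl : sqnorm (u_ k - l) <= e ^+ 2.
    by near: k; apply: near_sqnorm_lt.
  have kK : eps k <= e.
    by rewrite (le_trans _ Ke) // inv_le //; near: k; exists K.
  have := mxdot_le2 (- (u_ k - l)) (e *: (l - x)).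
  rewrite sqnormN sqnormZ mxdotNl mxdotZr => dot.
  have : - (2 * mxdot (u_ k - l) (l - x)) <= e * (1 + sqnorm (l - x)).
    by rewrite -(ler_pM2l e0); move: dot ukl; lra.
  move: sm; have -> : u_ k - x = (u_ k - l) + (l - x).
    by apply/matrixP => i j; rewrite !mxE; ring.
  move: (u_ k - l) (l - x) => a b; rewrite (sqnormD a b).
  by have := sqnorm_ge0 a; lra.
exists l => v /=.
have Fl : (phi l + (2^-1 * sqnorm (l - x))%:E <= m%:E)%E.
  move: (phiNy l) key; case: (phi l) => [r||] // _ key.
    rewrite -EFinD lee_fin leNgt; apply/negP => mr.
    have := key ((r + (m - 2^-1 * sqnorm (l - x))) / 2).
    by rewrite lte_fin => h; have : r + 2^-1 * sqnorm (l - x) <= m; lra.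
  exfalso; have := key (m - 2^-1 * sqnorm (l - x) + 1); rewrite ltey => /(_ isT) /=; lra.
apply: (le_trans Fl); move: (phiNy v) (@mF v); rewrite /F.
case: (phi v) => [r||] // _ mv; last by rewrite addye ?leey.
by rewrite -EFinD lee_fin; apply: mv; exists r.
Unshelve. all: by end_near.
Qed.

End Prox.

Section ProxSpec.
Variables (R : realType) (d : nat) (alpha : R) (psi : 'cV[R]_d -> \bar R).
Hypotheses (alpha_gt0 : 0 < alpha) (psi_proper : proper_fun psi).
Hypotheses (psi_closed : lower_semicontinuous psi) (psi_convex : convex_efun psi).

Let phi u := (alpha%:E * psi u)%E.

Let phi_proper : proper_fun phi.
Proof.
move: psi_proper => [psiNy [w psiw]]; split=> [x|].
  move: (psiNy x); rewrite /phi; case: (psi x) => [r||] // _.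
  by rewrite gt0_muley.
exists w; move: (psiNy w) psiw; rewrite /phi; case: (psi w) => //.
Qed.

Let phi_convex : convex_efun phi.
Proof.
move=> t x y t01; have := psi_convex x y t01; rewrite /phi.
have /andP[t0 t1] := t01; move: psi_proper => [psiNy _].
have scaleNy s z : 0 <= s -> (s%:E * psi z)%E \in [pred w | -oo < w]%E.
  rewrite inE le_eqVlt => /predU1P[<-|s0]; first by rewrite mul0e.
  by move: (psiNy z); case: (psi z) => [r||] // _; rewrite ?gt0_muley // -EFinM ltNyr.
move=> /(lee_wpmul2l (ltW alpha_gt0 : 0 <= alpha%:E)%E)/le_trans; apply.
rewrite muleDr // ?ltninfty_adde_def ?scaleNy ?subr_ge0 //.
by rewrite !(muleCA alpha%:E).
Qed.

Let phi_closed : lower_semicontinuous phi.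
Proof.
move=> x a; rewrite /phi => ax.
have [|V Vx Vpsi] := psi_closed (x := x) (a := alpha^-1 * a).
  by rewrite EFinM lte_pdivrMl.
by exists V => // y /Vpsi; rewrite EFinM lte_pdivrMl.
Qed.

Lemma subgradient_scale p g :
  subgradient psi p g -> subgradient phi p (alpha *: g).
Proof.
move=> [finp subp]; split=> [|u r]; first by rewrite fin_numM.
rewrite /phi -(fineK finp) /= mxdotZl; case upsi : (psi u) => [s||] //=.
- by move=> [<-]; rewrite -mulrDr ler_pM2l // subp.
- by rewrite gt0_muley.
- by rewrite gt0_muleNy.
Qed.

(** The subgradient at [p] supplies the affine minorant for existence, so [prox] is a true minimizer
    and not the default 0; Fermat's rule then applies. *)
Lemma prox_subgradient p g x : subgradient psi p g ->
  subgradient phi (prox alpha psi x) (x - prox alpha psi x).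
Proof.
move=> /subgradient_scale [finp subp].
have [|l lmin] := @prox_argmin_ex _ _ phi p (alpha *: g) (fine (phi p)) x
    phi_proper phi_convex phi_closed.
  move=> u; move: (phi_proper.1 u) (subp u).
  case: (phi u) => [r||] // _; last by rewrite leey.
  by rewrite lee_fin; apply.
have := xgetI 0 lmin; rewrite -/(prox alpha psi x).
move: (prox alpha psi x) => q qmin; rewrite -opprB.
apply: (@argmin_subgradient _ _ phi (fun u => 2^-1 * sqnorm (u - x)) q _ 2^-1) => //.
  move=> u; have -> : u - x = (u - q) + (q - x).
    by apply/matrixP => i j; rewrite !mxE; ring.
  by rewrite sqnormD (mxdotC (q - x)); lra.
by move=> v; rewrite addeC [leRHS]addeC; apply: qmin.
Qed.

Lemma prox_nonexpansive p g x y : subgradient psi p g ->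
  sqnorm (prox alpha psi x - prox alpha psi y) <= sqnorm (x - y).
Proof.
by move=> sp; apply: subgradient_nonexpansive; apply: prox_subgradient sp.
Qed.

(** [p] meets the optimality condition of the prox at [p + alpha *: g]; nonexpansiveness compares it
    with the prox at [x]. *)
Lemma prox_fixpoint_bound p g x : subgradient psi p g ->
  sqnorm (prox alpha psi x - p) <= sqnorm (x - alpha *: g - p).
Proof.
move=> sp; have -> : x - alpha *: g - p = x - (p + alpha *: g).
  by rewrite opprD addrA addrAC.
apply: subgradient_nonexpansive; first exact: prox_subgradient sp.
by rewrite addrC addKr; apply: subgradient_scale.
Qed.

End ProxSpec.

(** * Jacobian, smoothness operator and Bregman divergence *)

Section Jacobian.
Variables (R : realType) (d n : nat).
Variables (fs : 'I_n -> 'cV[R]_d -> R) (M : 'I_n -> 'M[R]_d).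
Implicit Types (X Y : 'M[R]_(d, n)) (x y : 'cV[R]_d).

(** [linfun] of a bare function keeps only its values on a basis; the linearity proof is packed into
    a structure so that [lfunE] applies. *)
Lemma linfun_linearE (aT rT : vectType R) (f : aT -> rT) : linear f ->
  linfun f =1 f.
Proof.
move=> lf; pose m := GRing.isLinear.Build _ _ _ _ f lf.
pose F : {linear aT -> rT} := HB.pack f m.
exact: (lfunE F).
Qed.

Lemma smoothness_opE X :
  smoothness_op M X = \matrix_(i, j) (M j *m col j X) i 0.
Proof.
rewrite linfun_linearE // => a Y Z; apply/matrixP => i j.
rewrite !mxE mulr_sumr -big_split; apply: eq_bigr => k _ /=.
by rewrite !mxE mulrDr mulrCA.
Qed.

Lemma mxdot_cols X Y : mxdot X Y = \sum_j mxdot (col j X) (col j Y).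
Proof.
rewrite mxdotE exchange_big /=; apply: eq_bigr => j _.
by rewrite mxdotE; apply: eq_bigr => i _; rewrite big_ord1 !mxE.
Qed.

Lemma col_jac j x : col j (jac fs x) = grad (fs j) x.
Proof. by apply/matrixP => i k; rewrite !mxE. Qed.

Lemma jac_ones x : jac fs x *m ones R n = \sum_j grad (fs j) x.
Proof.
apply/matrixP => i k; rewrite !mxE summxE; apply: eq_bigr => j _.
by rewrite !mxE mulr1.
Qed.

Lemma grad_avg_fun x : (forall j, differentiable (fs j) x) ->
  grad (avg_fun fs) x = n%:R^-1 *: (jac fs x *m ones R n).
Proof.
move=> df; apply/matrixP => i k; rewrite jac_ones !mxE summxE.
have -> : avg_fun fs = n%:R^-1 \*: \sum_(j < n) fs j.
  by apply/funext => y; rewrite /avg_fun fct_sumE.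
have dv j : derivable (fs j) x (delta_mx i 0) by apply: diff_derivable.
rewrite deriveZ ?derive_sum //; last exact: derivable_sum.
by congr (_ *: _); apply: eq_bigr => j _; rewrite mxE.
Qed.

Hypothesis fs_convex : forall j, convex_function [set: 'cV[R]_d] (fs j).
Hypothesis fs_smooth : forall j, smooth_wrt (fs j) (M j).

(** The Bregman divergence of the average, its gradient at [y] written through the Jacobian. *)
Let gap x y := avg_fun fs x - avg_fun fs y
  - mxdot (n%:R^-1 *: (jac fs y *m ones R n)) (x - y).

Let gap_sum x y : gap x y =
  n%:R^-1 * \sum_j (fs j x - fs j y - mxdot (grad (fs j) y) (x - y)).
Proof.
rewrite /gap /avg_fun !sumrB !mulrBr mxdotZl jac_ones; congr (_ - _ * _).
rewrite /mxdot linear_sum mulmx_suml linear_sum //.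
Qed.

Lemma jac_gap_ge x y (W : 'M[R]_(d, n)) :
  n%:R^-1 * (mxdot (jac fs x - jac fs y) W - 2^-1 * mxdot W (smoothness_op M W))
  <= gap x y.
Proof.
rewrite gap_sum ler_wpM2l ?invr_ge0 // !mxdot_cols mulr_sumr -sumrB.
apply: ler_sum => j _; rewrite linearB /= !col_jac.
have -> : col j (smoothness_op M W) = M j *m col j W.
  by rewrite smoothness_opE; apply/matrixP => i k; rewrite !mxE ord1.
exact: convex_smooth_gap.
Qed.

(* The junk value 0 of [op_sqrt] and [op_pinv] is harmless here: it makes the
   left-hand side 0. *)
Lemma pinv_sqrt_jac_le x y :
  n%:R^-1 * sqnorm (pinv_sqrt M (jac fs x - jac fs y)) <= 2 * gap x y.
Proof.
have gap0 : 0 <= gap x y.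
  by have := jac_gap_ge x y 0; rewrite linear0 !mxdot0r mulr0 subrr mulr0.
rewrite /pinv_sqrt; have [->|[selfP ->]] := op_sqrtP (op_pinv (smoothness_op M)).
  by rewrite lfunE /= sqnorm0 mulr0 mulr_ge0.
set A := smoothness_op M; set D := _ - jac fs y.
have [->|[_ PAP _ _]] := op_pinvP A.
  by rewrite lfunE /= mxdot0l mulr0 mulr_ge0.
(* For [W = op_pinv A D], self-adjointness and the second Penrose equation make the quadratic term
   equal to [mxdot D W], so half of it survives. *)
have := jac_gap_ge x y (op_pinv A D); rewrite -/D -/A.
have -> : mxdot (op_pinv A D) (A (op_pinv A D)) = mxdot D (op_pinv A D).
  by rewrite selfP -[in RHS]PAP !comp_lfunE.
by rewrite (mxdotC D); lra.
Qed.

(** Provides the quadratic upper bound that [argmin_subgradient] asks for at the solution. *)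
Lemma avg_fun_smooth (y : 'cV[R]_d) : exists C, forall x,
  avg_fun fs x <= avg_fun fs y
    + mxdot (n%:R^-1 *: (jac fs y *m ones R n)) (x - y) + C * sqnorm (x - y).
Proof.
have bound (j : 'I_n) :
    exists L : R, forall v : 'cV[R]_d, mxdot v (M j *m v) <= L * sqnorm v.
  by have [L _ LP] := mxdot_mulmx_bound (M j); exists L.
have [L LP] := choice bound.
exists (n%:R^-1 * \sum_j 2^-1 * L j) => x.
suff : gap x y <= n%:R^-1 * (\sum_j 2^-1 * L j) * sqnorm (x - y).
  by rewrite /gap; lra.
rewrite gap_sum -mulrA ler_wpM2l ?invr_ge0 // mulr_suml; apply: ler_sum => j _.
by have := fs_smooth j x y; have := LP j (x - y); lra.
Qed.

Lemma coord_jac_lipschitz i j : exists2 L, 0 < L &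
  forall x y, (jac fs x i j - jac fs y i j) ^+ 2 <= L * sqnorm (x - y).
Proof.
have [L L0 LP] := grad_lipschitz (fs_convex j) (fs_smooth j).
exists L => // x y; apply: le_trans (LP x y).
by have := coord_le_sqnorm (grad (fs j) x - grad (fs j) y) i 0; rewrite !mxE.
Qed.

End Jacobian.

(** * Measurability of matrix-valued maps *)

Section MatrixMeasurability.
Variables (R : realType) (disp : measure_display) (T : measurableType disp).

Definition mx_measurable p q (X : T -> 'M[R]_(p, q)) :=
  forall i j, measurable_fun [set: T] (fun w => X w i j).

Lemma mx_measurable_cst p q (X : 'M[R]_(p, q)) : mx_measurable (fun _ => X).
Proof. by move=> i j; exact: measurable_cst. Qed.

Lemma mx_measurableD p q (X Y : T -> 'M[R]_(p, q)) :
  mx_measurable X -> mx_measurable Y -> mx_measurable (fun w => X w + Y w).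
Proof.
move=> mX mY i j; under eq_fun do rewrite mxE.
exact: measurable_funD (mX i j) (mY i j).
Qed.

Lemma mx_measurableB p q (X Y : T -> 'M[R]_(p, q)) :
  mx_measurable X -> mx_measurable Y -> mx_measurable (fun w => X w - Y w).
Proof.
move=> mX mY i j; under eq_fun do rewrite !mxE.
exact: measurable_funB (mX i j) (mY i j).
Qed.

Lemma mx_measurableZ p q (a : R) (X : T -> 'M[R]_(p, q)) :
  mx_measurable X -> mx_measurable (fun w => a *: X w).
Proof.
move=> mX i j; under eq_fun do rewrite mxE.
exact: measurable_funM (measurable_cst _) (mX i j).
Qed.

Lemma mx_measurableMr p q r (X : T -> 'M[R]_(p, q)) (Y : 'M[R]_(q, r)) :
  mx_measurable X -> mx_measurable (fun w => X w *m Y).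
Proof.
move=> mX i j; under eq_fun do rewrite mxE.
apply: measurable_sum => k.
exact: measurable_funM (mX i k) (measurable_cst _).
Qed.

Lemma measurable_sqnorm p q (X : T -> 'M[R]_(p, q)) :
  mx_measurable X -> measurable_fun [set: T] (fun w => sqnorm (X w)).
Proof.
move=> mX; under eq_fun do rewrite sqnormE.
by do 2! (apply: measurable_sum => ?); exact: measurable_funX.
Qed.

(** The sigma-algebra on operators only controls evaluation at fixed matrices, hence the expansion
    of the random argument in the basis [delta_mx]. *)
Lemma mx_measurable_op d n (A : T -> 'End('M[R]_(d, n))) (X : T -> 'M[R]_(d, n)) :
  random_op A -> mx_measurable X -> mx_measurable (fun w => A w (X w)).
Proof.
move=> mA mX i j.
have coordA (Y : 'M[R]_(d, n)) : measurable_fun [set: T] (fun w => A w Y i j).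
  have mev : measurable_fun [set: opType R d n]
      (fun L : opType R d n => (L : 'End('M[R]_(d, n))) Y i j).
    move=> _ B mB; rewrite setTI; apply: sub_sigma_algebra.
    by exists Y, i, j, B.
  exact: measurableT_comp mev mA.
have -> : (fun w => A w (X w) i j) =
    (fun w => \sum_k \sum_l X w k l * A w (delta_mx k l) i j).
  apply/funext => w; rewrite [X in A w X](matrix_sum_delta (X w)).
  rewrite linear_sum summxE; apply: eq_bigr => k _.
  rewrite linear_sum summxE; apply: eq_bigr => l _.
  by rewrite linearZ mxE.
apply: measurable_sum => k; apply: measurable_sum => l.
exact: measurable_funM.
Qed.

Lemma floor_preimage_measurable (f : T -> R) (z : int) :
  measurable_fun [set: T] f -> measurable [set w | Num.floor (f w) = z].
Proof.
move=> mf.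
have -> : [set w | Num.floor (f w) = z] =
    [set: T] `&` f @^-1` `[z%:~R, (z + 1)%:~R[%classic.
  rewrite setTI; apply/seteqP; split=> w /=; rewrite in_itv /=.
    by move=> <-; apply: real_floor_itv; rewrite num_real.
  exact: floor_def.
by apply: mf => //; exact: measurable_itv.
Qed.

(* Lipschitz functions of matrices with measurable entries are limits of
   functions of the entries rounded to the grid of mesh 1/(m+1). *)
Lemma measurable_lipschitz p q (h : 'M[R]_(p, q) -> R) (L : R)
    (X : T -> 'M[R]_(p, q)) : 0 < L ->
  (forall x y, (h x - h y) ^+ 2 <= L * sqnorm (x - y)) ->
  mx_measurable X -> measurable_fun [set: T] (fun w => h (X w)).
Proof.
move=> L0 hL mX.
pose z (m : nat) w : 'M[int]_(p, q) :=
  \matrix_(i, j) Num.floor (m.+1%:R * X w i j).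
pose G (m : nat) (Z : 'M[int]_(p, q)) : 'M[R]_(p, q) :=
  \matrix_(i, j) ((Z i j)%:~R / m.+1%:R).
apply: (@measurable_fun_cvg _ _ _ _ (fun m w => h (G m (z m w)))) => [m|w _].
  move=> _ B mB; rewrite setTI.
  (* The rounded matrix takes countably many values, enumerated by [unpickle]. *)
  have -> : (fun w => h (G m (z m w))) @^-1` B =
      \bigcup_k [set w | exists2 Z, unpickle k = Some Z
                         & B (h (G m Z)) /\ z m w = Z].
    apply/seteqP; split=> [w Bw|w [k _ [Z _ [BZ zZ]]]]; last by rewrite /= zZ.
    by exists (pickle (z m w)) => //; exists (z m w); rewrite ?pickleK.
  apply: bigcup_measurable => k _.
  case: (unpickle k) => [Z|]; last first.
    rewrite (_ : [set _ | _] = set0) //.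
    by apply/seteqP; split=> // w [].
  have [BZ|nBZ] := pselect (B (h (G m Z))); last first.
    rewrite (_ : [set _ | _] = set0) //.
    by apply/seteqP; split=> // w [_ [<-] []].
  rewrite (_ : [set _ | _] = \bigcap_(ij in [set: 'I_p * 'I_q])
      [set w | Num.floor (m.+1%:R * X w ij.1 ij.2) = Z ij.1 ij.2]).
    apply: fin_bigcap_measurable => // -[i j] _ /=.
    apply: floor_preimage_measurable.
    exact: measurable_funM (measurable_cst _) (mX i j).
  apply/seteqP; split=> [w [Z' [ZZ] [_ zZ]] [i j] _ /=|w Zw].
    by rewrite ZZ -zZ mxE.
  exists Z => //; split => //; apply/matrixP => i j; rewrite mxE.
  exact: (Zw (i, j) I).
pose C := L * (p * q)%:R.
have C0 : 0 <= C by rewrite mulr_ge0 // ltW.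
(* Each of the [p * q] entries moves by at most [m.+1%:R^-1], whose square is at most itself. *)
have hC m : (h (X w) - h (G m (z m w))) ^+ 2 <= C / m.+1%:R.
  have m0 : (0 : R) < m.+1%:R by [].
  rewrite (le_trans (hL _ _)) // /C -mulrA ler_wpM2l ?(ltW L0) //.
  rewrite sqnormE (@le_trans _ _ (\sum_(i < p) \sum_(j < q) m.+1%:R^-1)) //.
    apply: ler_sum => i _; apply: ler_sum => j _; rewrite !mxE.
    set a := m.+1%:R * X w i j.
    have -> : X w i j = a / m.+1%:R by rewrite /a mulrAC divff ?mul1r // gt_eqF.
    rewrite -mulrBl.
    have /andP[lea lta] := real_floor_itv (num_real a).
    move: lta; rewrite intrD => lta.
    rewrite exprMn expr2 [X in _ * X]expr2 mulrA -[leRHS]mul1r ler_pM2r ?invr_gt0 //.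
    rewrite -[leRHS]mulr1 ler_pM ?mulr_ge0 ?subr_ge0 ?invr_ge0 ?(ltW m0) //.
      rewrite -[leRHS]mulr1 ler_pM ?subr_ge0 //; rewrite ?lerBlDl ltW //.
    by rewrite invf_le1 // ler1n.
  by rewrite !sumr_const !card_ord -mulrnA -[leLHS]mulr_natl mulnC.
apply/cvgrPdist_le => e e0.
near=> m.
rewrite -(ler_pXn2r (_ : 0 < 2)%N) ?nnegrE ?(ltW e0) // real_normK ?num_real //.
rewrite (le_trans (hC m)) // ler_pdivrMr // -ler_pdivrMl ?exprn_gt0 //.
near: m; exists (Num.trunc ((e ^+ 2)^-1 * C)) => // m /= cm.
rewrite (le_trans (ltW (truncnS_gt _))) // ler_nat ltnS //.
Unshelve. all: by end_near.
Qed.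

End MatrixMeasurability.

(** * Expectations *)

Section HasMean.
Variables (R : realType) (disp : measure_display) (T : measurableType disp).
Variable P : probability T R.
Implicit Types (f g : T -> R) (a b : R).

(** Bundling integrability with a real value lets means be combined linearly without side conditions
    in the extended reals. *)
Definition has_mean f a : Prop :=
  P.-integrable [set: T] (EFin \o f) /\ ('E_P[f] = a%:E)%E.

Lemma has_mean_cst a : has_mean (fun _ => a) a.
Proof.
split; first exact: finite_measure_integrable_cst.
exact: expectation_cst.
Qed.

Lemma has_meanD f g a b :
  has_mean f a -> has_mean g b -> has_mean (fun w => f w + g w) (a + b).
Proof.
move=> [intf Ef] [intg Eg]; split.
  exact: (integrableD measurableT intf intg).
move: Ef Eg; rewrite unlock => Ef Eg.
under eq_integral do rewrite EFinD.
by rewrite integralD // Ef Eg.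
Qed.

Lemma has_meanZ c f a : has_mean f a -> has_mean (fun w => c * f w) (c * a).
Proof.
move=> [intf Ef]; split; first exact: (integrableZl measurableT _ intf).
move: Ef; rewrite unlock => Ef.
under eq_integral do rewrite EFinM.
by rewrite integralZl // Ef.
Qed.

Lemma has_meanN f a : has_mean f a -> has_mean (fun w => - f w) (- a).
Proof.
move=> /(has_meanZ (-1)); rewrite mulN1r.
by under eq_fun do rewrite mulN1r.
Qed.

Lemma has_meanB f g a b :
  has_mean f a -> has_mean g b -> has_mean (fun w => f w - g w) (a - b).
Proof. by move=> mf /has_meanN; apply: has_meanD. Qed.

Lemma has_mean_sum I (s : seq I) (f : I -> T -> R) (a : I -> R) :
  (forall i, has_mean (f i) (a i)) ->
  has_mean (fun w => \sum_(i <- s) f i w) (\sum_(i <- s) a i).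
Proof.
move=> mf; elim: s => [|i s IH].
  by under eq_fun do rewrite big_nil; rewrite big_nil; exact: has_mean_cst.
under eq_fun do rewrite big_cons.
by rewrite big_cons; exact: has_meanD.
Qed.

Lemma has_mean_unique f a b : has_mean f a -> has_mean f b -> a = b.
Proof. by move=> [_ Ea] [_]; rewrite Ea => -[]. Qed.

Lemma has_mean_ge0 f a : (forall w, 0 <= f w) -> has_mean f a -> 0 <= a.
Proof.
move=> f0 [_ Ef]; rewrite -lee_fin -Ef.
by apply: expectation_ge0.
Qed.

Lemma ae_le_has_mean f g a : measurable_fun [set: T] f -> (forall w, 0 <= f w) ->
  {ae P, forall w, f w <= g w} -> has_mean g a -> ('E_P[f] <= a%:E)%E.
Proof.
move=> mf f0 fg [intg Eg].
have mg : measurable_fun [set: T] g.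
  by apply/measurable_EFinP; move: intg => /integrableP[].
have mfg : measurable_fun [set: T] (f \max g) by exact: measurable_maxr.
(* [g] may be negative on a null set; [f \max g] has the same mean and is nonnegative everywhere. *)
have <- : ('E_P[f \max g] = a%:E)%E.
  rewrite -Eg unlock; apply: ae_eq_integral => //; try exact/measurable_EFinP.
  by apply: filterS fg => w fgw _ /=; rewrite max_r.
apply: expectation_le => //= [w|]; first by rewrite le_max f0.
by apply: filterS fg => w _; rewrite le_max lexx.
Qed.

End HasMean.

Section RandomOperatorMeans.
Variables (R : realType) (d n : nat).
Variables (disp : measure_display) (T : measurableType disp).
Variable P : probability T R.
Local Notation op := 'End('M[R]_(d, n)).
Implicit Types (X Y : 'M[R]_(d, n)).

Lemma orth_proj_mxdot (A : op) X Y : orth_proj A ->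
  mxdot (A X) (A Y) = mxdot (A X) Y.
Proof. by move=> [selfA AA]; rewrite -[in RHS]AA comp_lfunE; apply/esym/selfA. Qed.

Lemma sqnorm_orth_proj_le (A : op) X : orth_proj A -> sqnorm (A X) <= sqnorm X.
Proof.
move=> pA; have := sqnorm_ge0 (X - A X).
rewrite sqnormB mxdotC -(orth_proj_mxdot X X pA) -/(sqnorm (A X)); lra.
Qed.

(** Pythagoras for [X - A X] and [A Y]. The result is linear in [A], so its mean only involves
    [op_mean]. *)
Lemma orth_proj_split (A : op) X Y : orth_proj A ->
  sqnorm (X - A (X - Y)) = sqnorm X - mxdot (A X) X + mxdot (A Y) Y.
Proof.
move=> pA; rewrite linearB /= opprB addrA addrAC sqnormD.
rewrite sqnormB mxdotBl (mxdotC X) -(orth_proj_mxdot X X pA).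
rewrite (mxdotC X (A Y)) (mxdotC (A X) (A Y)) (orth_proj_mxdot Y X pA).
rewrite -(orth_proj_mxdot Y Y pA) /sqnorm; lra.
Qed.

Lemma has_mean_mxdot p q (X : T -> 'M[R]_(p, q)) (m Y : 'M[R]_(p, q)) :
  (forall i j, has_mean P (fun w => X w i j) (m i j)) ->
  has_mean P (fun w => mxdot (X w) Y) (mxdot m Y).
Proof.
move=> mX; under eq_fun do rewrite mxdotE.
rewrite mxdotE; do 2! (apply: has_mean_sum => ?).
under eq_fun do rewrite mulrC.
by rewrite mulrC; exact: has_meanZ.
Qed.

Lemma has_mean_unbiased (U : T -> op) X Y : unbiased P U ->
  has_mean P (fun w => mxdot (U w X) Y) (mxdot X Y).
Proof. by move=> uU; apply: has_mean_mxdot => i j; apply: uU. Qed.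

Variable S : T -> op.
Hypotheses (S_random : random_op S) (S_proj : forall w, orth_proj (S w)).

Let coord_integrable X i j :
  P.-integrable [set: T] (EFin \o (fun w => S w X i j)).
Proof.
apply: measurable_bounded_integrable => //.
- by rewrite (le_lt_trans (probability_le1 _ _)) // ltry.
- exact: (mx_measurable_op S_random (@mx_measurable_cst _ _ T _ _ X) i j).
(* A projection does not increase the norm, and [a ^+ 2 + 1] dominates the absolute value of an
   entry [a]. *)
exists (sqnorm X + 1); split; first by rewrite num_real.
move=> M XM w _ /=; apply: ltW; apply: le_lt_trans XM.
have := coord_le_sqnorm (S w X) i j; have := sqnorm_orth_proj_le X (S_proj w).
rewrite -real_normK ?num_real // => h1 h2.
have := sqr_ge0 (`|S w X i j| - 1); rewrite sqrrB1 -mulr_natl; move: h1 h2; nra.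
Qed.

Lemma op_meanE X i j : has_mean P (fun w => S w X i j) (op_mean P S X i j).
Proof.
split; first exact: coord_integrable.
have E_fin Y k l : ('E_P[fun w => S w Y k l])%E \is a fin_num.
  by rewrite unlock; apply: integrable_fin_num => //; exact: coord_integrable.
(* [op_mean] is built by [linfun], so linearity of the entrywise means has to be checked. *)
rewrite linfun_linearE ?mxE ?fineK // => a Y Z; apply/matrixP => k l.
rewrite !mxE; apply/EFin_inj; rewrite EFinD EFinM !fineK //.
have mY : has_mean P (fun w => S w Y k l) (fine 'E_P[fun w => S w Y k l]).
  by split; [exact: coord_integrable|rewrite fineK].
have mZ : has_mean P (fun w => S w Z k l) (fine 'E_P[fun w => S w Z k l]).
  by split; [exact: coord_integrable|rewrite fineK].
have [_] := has_meanD (has_meanZ a mY) mZ; rewrite EFinD EFinM !fineK // => <-.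
by congr ('E_P[_])%E; apply/funext => w; rewrite linearP !mxE.
Qed.

Lemma has_mean_op_mean X Y :
  has_mean P (fun w => mxdot (S w X) Y) (mxdot (op_mean P S X) Y).
Proof. by apply: has_mean_mxdot => i j; apply: op_meanE. Qed.

Let op_mean_self : self_adjoint (op_mean P S).
Proof.
move=> X Y; apply: has_mean_unique (has_mean_op_mean X Y) _.
rewrite mxdotC; have := has_mean_op_mean Y X.
by congr (has_mean P _ _); apply/funext => w; rewrite mxdotC (S_proj w).1.
Qed.

Lemma psd_op_mean : psd_op (op_mean P S).
Proof.
split=> // X; apply: has_mean_ge0 (has_mean_op_mean X X) => w.
by rewrite -orth_proj_mxdot // sqnorm_ge0.
Qed.

Lemma psd_id_sub_op_mean : psd_op (\1%VF - op_mean P S).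
Proof.
split=> [X Y|X]; rewrite !(add_lfunE, opp_lfunE, id_lfunE).
  by rewrite mxdotBl mxdotBr op_mean_self.
rewrite mxdotBl; apply: has_mean_ge0 (has_meanB (has_mean_cst _ _)
  (has_mean_op_mean X X)) => w.
rewrite -orth_proj_mxdot // subr_ge0.
exact: sqnorm_orth_proj_le.
Qed.

End RandomOperatorMeans.

(** * One step of the method *)

(** Here [N] is [n^-1], [v] the squared distance to [xs], [uY] and [uD] are second moments, [eY] and
    [eD] quadratic forms of the mean projection, [gx] and [gxs] gradient terms. Multiply the three
    inequalities by [a] and add; the term in [sY] has a favourable sign. *)
Lemma one_step_arithmetic (R : realFieldType)
    (a s N uY uD sY qY eY eD fx fxs gx gxs v : R) :
  0 <= a -> 0 <= sY ->
  2 * a * N ^+ 2 * uY + (qY - eY) <= (1 - a * s) * qY ->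
  2 * a * N ^+ 2 * uD + eD <= 2 * (fx - fxs - N * gxs) ->
  fx - N * gx + s / 2 * v <= fxs ->
  v - 2 * a * N * (gx - gxs)
    + a ^+ 2 * N ^+ 2 * (2 * uD + 2 * (sY - 2 * sY + uY)) + a * (qY - eY + eD)
  <= (1 - a * s) * (v + a * qY).
Proof.
move=> a0 sY0 c1 c2 qsc.
have := mulr_ge0 (mulr_ge0 (sqr_ge0 a) (sqr_ge0 N)) sY0.
move: (ler_wpM2l a0 c1) (ler_wpM2l a0 c2) (ler_wpM2l a0 qsc); lra.
Qed.

Section GJSStep.
Variables (R : realType) (d n : nat).
Local Notation op := 'End('M[R]_(d, n)).
Variables (fs : 'I_n -> 'cV[R]_d -> R) (psi : 'cV[R]_d -> \bar R).
Variables (M : 'I_n -> 'M[R]_d) (sigma alpha : R) (xs : 'cV[R]_d).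
Hypothesis fs_diff : forall j x, differentiable (fs j) x.
Hypothesis fs_convex : forall j, convex_function [set: 'cV[R]_d] (fs j).
Hypothesis psi_proper : proper_fun psi.
Hypothesis psi_closed : lower_semicontinuous psi.
Hypothesis psi_convex : convex_efun psi.
Hypothesis xs_min : argmin (fun x => ((avg_fun fs x)%:E + psi x)%E) xs.
Hypothesis f_qsc : quasi_strongly_convex (avg_fun fs) sigma xs.
Hypothesis fs_smooth : forall j, smooth_wrt (fs j) (M j).
Hypothesis alpha_gt0 : 0 < alpha.

Local Notation e := (ones R n).
Local Notation G := (jac fs).

(** One iteration as a deterministic map of the state and the drawn operators, which separates the
    fresh randomness from the past. *)
Definition gjs_step (z : 'cV[R]_d * 'M[R]_(d, n)) (s u : op) :=
  let g := n%:R^-1 *: (z.2 *m e) + n%:R^-1 *: (u (G z.1 - z.2) *m e) in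
  (prox alpha psi (z.1 - alpha *: g), z.2 - s (z.2 - G z.1)).

Lemma gjsS x0 J0 (S U : nat -> op) k :
  gjs alpha psi fs x0 J0 S U k.+1 =
  gjs_step (gjs alpha psi fs x0 J0 S U k) (S k) (U k).
Proof. by rewrite /=; case: gjs. Qed.

Lemma subgradient_solution : subgradient psi xs (- (n%:R^-1 *: (G xs *m e))).
Proof.
have [C smooth] := avg_fun_smooth fs_smooth xs.
exact: argmin_subgradient psi_proper psi_convex smooth xs_min.
Qed.

Section Measurability.
Variables (disp : measure_display) (T : measurableType disp).

(** The only nonlinear maps, the Jacobian and the prox, are Lipschitz in each coordinate. *)
Lemma gjs_step_measurable (z : T -> 'cV[R]_d * 'M[R]_(d, n)) (S U : T -> op) :
  random_op S -> random_op U ->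
  mx_measurable (fun w => (z w).1) -> mx_measurable (fun w => (z w).2) ->
  mx_measurable (fun w => (gjs_step (z w) (S w) (U w)).1) /\
  mx_measurable (fun w => (gjs_step (z w) (S w) (U w)).2).
Proof.
move=> mS mU mx mJ.
have mG : mx_measurable (fun w => G (z w).1).
  move=> i j; have [L L0 GL] := coord_jac_lipschitz fs_convex fs_smooth i j.
  exact: (@measurable_lipschitz _ _ _ _ _ (fun x => G x i j) L).
split; last first.
  apply: mx_measurableB => //; apply: mx_measurable_op => //.
  exact: mx_measurableB.
move=> i j.
apply: (@measurable_lipschitz _ _ _ _ _ (fun x => prox alpha psi x i j) 1).
- exact: ltr01.
- move=> x y; rewrite mul1r.
  have := prox_nonexpansive alpha_gt0 psi_proper psi_closed psi_convex x y
    subgradient_solution.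
  apply: le_trans; have := coord_le_sqnorm (prox alpha psi x - prox alpha psi y) i j.
  by rewrite !mxE.
- apply: mx_measurableB => //; apply: mx_measurableZ; apply: mx_measurableD.
    by apply: mx_measurableZ; apply: mx_measurableMr.
  apply: mx_measurableZ; apply: mx_measurableMr; apply: mx_measurable_op => //.
  exact: mx_measurableB.
Qed.

(** Only draws before [k] are constrained, so the lemma also applies over the sigma-algebra of the
    past. *)
Lemma gjs_measurable x0 J0 (S U : nat -> T -> op) k :
  (forall i, (i < k)%N -> random_op (S i) /\ random_op (U i)) ->
  let z w := gjs alpha psi fs x0 J0 (S ^~ w) (U ^~ w) k in
  mx_measurable (fun w => (z w).1) /\ mx_measurable (fun w => (z w).2).
Proof.
elim: k => [|k IH] mSU z; first by split; apply: mx_measurable_cst.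
have [|mx mJ] := IH; first by move=> i ik; apply: mSU; apply: ltnW.
have [mS mU] := mSU k (leqnn _).
rewrite (_ : z = fun w => gjs_step
  (gjs alpha psi fs x0 J0 (S ^~ w) (U ^~ w) k) (S k w) (U k w)).
  exact: gjs_step_measurable.
by apply/funext => w; rewrite /z gjsS.
Qed.

Lemma lyapunov_measurable (B : op) (Gs : 'M[R]_(d, n))
    (z : T -> 'cV[R]_d * 'M[R]_(d, n)) :
  mx_measurable (fun w => (z w).1) -> mx_measurable (fun w => (z w).2) ->
  measurable_fun [set: T] (fun w => lyapunov alpha B M xs Gs (z w)).
Proof.
move=> mx mJ; apply: measurable_funD.
  by apply: measurable_sqnorm; apply: mx_measurableB => //; apply: mx_measurable_cst.
apply: measurable_funM => //; apply: measurable_sqnorm.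
apply: mx_measurable_op; first exact: measurable_cst.
apply: mx_measurable_op; first exact: measurable_cst.
by apply: mx_measurableB => //; apply: mx_measurable_cst.
Qed.

End Measurability.

Lemma lyapunov_ge0 (B : op) (Gs : 'M[R]_(d, n)) z :
  0 <= lyapunov alpha B M xs Gs z.
Proof. by rewrite addr_ge0 ?mulr_ge0 ?sqnorm_ge0 ?(ltW alpha_gt0). Qed.

Section OneStep.
Hypothesis n_gt0 : (0 < n)%N.
Variables (disp : measure_display) (T : measurableType disp).
Variables (P : probability T R) (S U : T -> op) (B Rop : op).
Hypotheses (S_random : random_op S) (U_random : random_op U).
Hypothesis S_proj : forall w, orth_proj (S w).
Hypothesis U_unbiased : unbiased P U.
Hypothesis B_comm : commutes_with P B S.
Hypothesis M_comm : commutes_with P (pinv_sqrt M) S.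
Local Notation Q X := (B (pinv_sqrt M X)).
Hypothesis cond1 : forall X : 'M[R]_(d, n), Rop X = 0 ->
  ((2 * alpha / n%:R ^+ 2)%:E * 'E_P[fun w => sqnorm (U w X *m e)]
   + (sqnorm (op_sqrt (\1%VF - op_mean P S) (Q X)))%:E
   <= ((1 - alpha * sigma) * sqnorm (Q X))%:E)%E.
Hypothesis cond2 : forall X : 'M[R]_(d, n),
  ((2 * alpha / n%:R ^+ 2)%:E * 'E_P[fun w => sqnorm (U w X *m e)]
   + (sqnorm (op_sqrt (op_mean P S) (Q X)))%:E
   <= (n%:R^-1 * sqnorm (pinv_sqrt M X))%:E)%E.

Let u2 (X : 'M[R]_(d, n)) := fine ('E_P[fun w => sqnorm (U w X *m e)])%E.

Let c_gt0 : 0 < 2 * alpha / n%:R ^+ 2.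
Proof. by rewrite divr_gt0 ?mulr_gt0 ?exprn_gt0 ?ltr0n. Qed.

(** Finiteness comes from [cond2]: its right-hand side is finite and the moment has a positive
    coefficient. *)
Lemma has_mean_sqnorm_U X : has_mean P (fun w => sqnorm (U w X *m e)) (u2 X).
Proof.
have mU : measurable_fun [set: T] (fun w => sqnorm (U w X *m e)).
  apply: measurable_sqnorm; apply: mx_measurableMr.
  exact: mx_measurable_op (@mx_measurable_cst _ _ T _ _ X).
have E0 : (0 <= 'E_P[fun w => sqnorm (U w X *m e)])%E.
  by apply: expectation_ge0 => w; exact: sqnorm_ge0.
have E_fin : ('E_P[fun w => sqnorm (U w X *m e)] < +oo)%E.
  have := cond2 X; move: E0; case: ('E_P[_])%E => [r||] //= _; first by rewrite ltry.
  by rewrite gt0_muley ?lte_fin.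
split; last by rewrite /u2 fineK // ge0_fin_numE.
apply/integrableP; split; first exact/measurable_EFinP.
move: E_fin; rewrite unlock; congr (_ < _)%E.
by apply: eq_integral => w _; rewrite /= ger0_norm // sqnorm_ge0.
Qed.

(** The adjoint of [X *m e] moves [e] to the deterministic side, where unbiasedness of [U] can be
    used. *)
Lemma mxdot_mulmxr (X : 'M[R]_(d, n)) (v : 'cV[R]_d) :
  mxdot (X *m e) v = mxdot X (v *m e^T).
Proof. by rewrite /mxdot trmx_mul -!mulmxA mxtrace_mulC mulmxA mxtrace_mulC mulmxA. Qed.

Lemma gjs_step_expectation x J : Rop J = Rop (G xs) ->
  ('E_P[fun w => lyapunov alpha B M xs (G xs) (gjs_step (x, J) (S w) (U w))]
   <= ((1 - alpha * sigma) * lyapunov alpha B M xs (G xs) (x, J))%:E)%E.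
Proof.
move=> RJ.
pose Y := J - G xs; pose D := G x - G xs; pose v := x - xs.
have RY : Rop Y = 0 by rewrite linearB /= RJ subrr.
(* A pointwise upper bound made only of terms with known means: linear in [S w], linear in [U w], or
   second moments of [U w]; [m] is its mean. *)
pose bound w :=
  sqnorm v
  - 2 * alpha * n%:R^-1 * (mxdot (Y *m e) v + mxdot (U w (D - Y)) (v *m e^T))
  + alpha ^+ 2 * n%:R^-1 ^+ 2 * (2 * sqnorm (U w D *m e)
      + 2 * (sqnorm (Y *m e) - 2 * mxdot (U w Y) (Y *m e *m e^T)
             + sqnorm (U w Y *m e)))
  + alpha * (sqnorm (Q Y) - mxdot (S w (Q Y)) (Q Y) + mxdot (S w (Q D)) (Q D)).
pose m := sqnorm v
  - 2 * alpha * n%:R^-1 * (mxdot (Y *m e) v + mxdot (D - Y) (v *m e^T))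
  + alpha ^+ 2 * n%:R^-1 ^+ 2 * (2 * u2 D
      + 2 * (sqnorm (Y *m e) - 2 * mxdot Y (Y *m e *m e^T) + u2 Y))
  + alpha * (sqnorm (Q Y) - mxdot (op_mean P S (Q Y)) (Q Y)
             + mxdot (op_mean P S (Q D)) (Q D)).
have mean_bound : has_mean P bound m.
  apply: has_meanD; first (apply: has_meanD; first (apply: has_meanB)).
  - exact: has_mean_cst.
  - apply: has_meanZ; apply: has_meanD; first exact: has_mean_cst.
    exact: has_mean_unbiased.
  - apply: has_meanZ; apply: has_meanD; first exact/has_meanZ/has_mean_sqnorm_U.
    apply: has_meanZ; apply: has_meanD; last exact: has_mean_sqnorm_U.
    apply: has_meanB; first exact: has_mean_cst.
    by apply: has_meanZ; exact: has_mean_unbiased.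
  - apply: has_meanZ; apply: has_meanD; last exact: has_mean_op_mean.
    apply: has_meanB; first exact: has_mean_cst.
    exact: has_mean_op_mean.
have step_meas : measurable_fun [set: T]
    (fun w => lyapunov alpha B M xs (G xs) (gjs_step (x, J) (S w) (U w))).
  have [mx mJ] := @gjs_step_measurable _ T (fun=> (x, J)) S U S_random U_random
    (@mx_measurable_cst _ _ T _ _ x) (@mx_measurable_cst _ _ T _ _ J).
  exact: lyapunov_measurable.
have step_le : {ae P, forall w,
    lyapunov alpha B M xs (G xs) (gjs_step (x, J) (S w) (U w)) <= bound w}.
  apply: filterS2 B_comm M_comm => w BS MS.
  have QS X : Q (S w X) = S w (Q X).
    by move/lfunP/(_ X): MS; rewrite !comp_lfunE => ->;
       move/lfunP/(_ (pinv_sqrt M X)): BS; rewrite !comp_lfunE.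
  rewrite /lyapunov /gjs_step /=.
  have GJ : G x - J = D - Y.
    by rewrite /D /Y; apply/matrixP => i j; rewrite !mxE; ring.
  have JG : J - S w (J - G x) - G xs = Y - S w (Y - D).
    by rewrite -[J - G x]opprB GJ -[Y - D]opprB /Y addrAC.
  have QB X Z : Q (X - Z) = Q X - Q Z by rewrite !linearB.
  have QE : Q (Y - S w (Y - D)) = Q Y - S w (Q Y - Q D).
    by rewrite (QB Y) QS (QB Y).
  rewrite JG QE (orth_proj_split (Q Y) (Q D) (S_proj w)).
  rewrite GJ.
  set g := n%:R^-1 *: _ + _.
  have := prox_fixpoint_bound alpha_gt0 psi_proper psi_closed psi_convex
    (x - alpha *: g) subgradient_solution.
  rewrite scalerN opprK.
  (* [h] is the gradient estimate minus the gradient at the solution. *)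
  set h := n%:R^-1 *: (Y *m e + U w (D - Y) *m e).
  have -> : x - alpha *: g + alpha *: (n%:R^-1 *: (G xs *m e)) - xs = v - alpha *: h.
    have YE : Y *m e = J *m e - G xs *m e by rewrite mulmxBl.
    rewrite /h /g /v YE; move: (J *m e) (G xs *m e) (U w _ *m e) => a b c.
    by apply/matrixP => i j; rewrite !mxE; ring.
  rewrite (sqnormB v) sqnormZ mxdotZr (mxdotC v).
  have -> : mxdot h v = n%:R^-1 * (mxdot (Y *m e) v + mxdot (U w (D - Y)) (v *m e^T)).
    by rewrite mxdotZl mxdotDl (mxdot_mulmxr (U w _)).
  have : sqnorm h <= n%:R^-1 ^+ 2 * (2 * sqnorm (U w D *m e)
      + 2 * (sqnorm (Y *m e) - 2 * mxdot (U w Y) (Y *m e *m e^T)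
             + sqnorm (U w Y *m e))).
    rewrite sqnormZ ler_wpM2l ?exprn_ge0 ?invr_ge0 //.
    (* The second group has mean zero, so its second moment is that of [U w Y *m e] minus
       [sqnorm (Y *m e)]. *)
    have -> : Y *m e + U w (D - Y) *m e = U w D *m e + (Y *m e - U w Y *m e).
      have -> : U w (D - Y) = U w D - U w Y by exact: linearB.
      by rewrite (mulmxBl (U w D)) addrCA.
    apply: le_trans (sqnormD_le2 _ _) _.
    by rewrite sqnormB (mxdotC (Y *m e)) mxdot_mulmxr.
  have a20 : 0 < alpha ^+ 2 by rewrite exprn_gt0.
  rewrite -(ler_pM2l a20) /bound; lra.
apply: (le_trans (ae_le_has_mean step_meas _ step_le mean_bound)).
  by move=> w; exact: lyapunov_ge0.
rewrite lee_fin.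
have c1 : 2 * alpha / n%:R ^+ 2 * u2 Y
    + (sqnorm (Q Y) - mxdot (op_mean P S (Q Y)) (Q Y))
    <= (1 - alpha * sigma) * sqnorm (Q Y).
  have := cond1 RY; rewrite (has_mean_sqnorm_U Y).2.
  rewrite (sqnorm_op_sqrt _ (psd_id_sub_op_mean P S_random S_proj)).
  by rewrite add_lfunE opp_lfunE id_lfunE mxdotBl.
have c2 : 2 * alpha / n%:R ^+ 2 * u2 D + mxdot (op_mean P S (Q D)) (Q D)
    <= 2 * (avg_fun fs x - avg_fun fs xs - mxdot (n%:R^-1 *: (G xs *m e)) v).
  apply: le_trans (pinv_sqrt_jac_le fs_convex fs_smooth x xs).
  have := cond2 D; rewrite (has_mean_sqnorm_U D).2.
  by rewrite (sqnorm_op_sqrt _ (psd_op_mean P S_random S_proj)).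
have := f_qsc x; rewrite grad_avg_fun // -opprB mxdotNr -/v mxdotZl => qsc.
have YY : mxdot Y (Y *m e *m e^T) = sqnorm (Y *m e) by rewrite -mxdot_mulmxr.
(* In the mean the terms in [Y] cancel: the gradient estimate is unbiased. *)
have DY : mxdot (Y *m e) v + mxdot (D - Y) (v *m e^T)
    = mxdot (G x *m e) v - mxdot (G xs *m e) v.
  rewrite -mxdot_mulmxr (mulmxBl D) mxdotBl addrCA subrr addr0.
  by rewrite /D mulmxBl mxdotBl.
rewrite /m YY DY /lyapunov /= -/v -/Y.
rewrite mxdotZl in c2.
move: c1 c2 qsc; rewrite -exprVn.
move: (sqnorm_ge0 (Y *m e)).
move: (n%:R^-1) (sqnorm (Y *m e)) (sqnorm (Q Y)) (mxdot _ (Q Y)) (mxdot _ (Q D)).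
move=> N sYe sQY eQY eQD sYe0 c1 c2 qsc.
exact: one_step_arithmetic (ltW alpha_gt0) sYe0 c1 c2 qsc.
Qed.

End OneStep.

End GJSStep.

(** * Independence of the past *)

Section Independence.
Local Open Scope ereal_scope.
Context (R : realType) (d d1 d2 : measure_display).
Context (T : measurableType d) (T1 : measurableType d1) (T2 : measurableType d2).
Variables (P : probability T R) (X : {mfun T >-> T1}) (V : {mfun T >-> T2}).
Hypothesis indep : forall A B, measurable A -> measurable B ->
  P (X @^-1` A `&` V @^-1` B) = P (X @^-1` A) * P (V @^-1` B).
Variable h : T1 * T2 -> \bar R.
Hypotheses (h_meas : measurable_fun [set: T1 * T2] h) (h_ge0 : forall z, 0 <= h z).

Lemma measurable_section_integral :
  measurable_fun [set: T] (fun w => \int[distribution P V]_v h (X w, v)).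
Proof.
have := @measurable_fun_fubini_tonelli_F _ _ _ _ _ (distribution P V) h h_meas h_ge0.
by move=> mF; apply: (measurableT_comp mF).
Qed.

(** Independence on rectangles identifies the law of the pair with the product of the laws; Tonelli
    then integrates over [V] with [X] frozen. *)
Lemma independent_integral :
  \int[P]_w h (X w, V w) = \int[P]_w \int[distribution P V]_v h (X w, v).
Proof.
have mXV : measurable_fun [set: T] (fun w => (X w, V w)).
  exact: measurable_fun_pair.
pose XVmix := isMeasurableFun.Build _ _ _ _ _ mXV.
pose XV : {mfun T >-> (T1 * T2)%type} := HB.pack (fun w => (X w, V w)) XVmix.
rewrite -[LHS](ge0_integral_distribution XV h_meas h_ge0).
rewrite (eq_measure_integral (distribution P X \x distribution P V)).
  rewrite fubini_tonelli1 // ge0_integral_distribution //.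
    exact: measurable_fun_fubini_tonelli_F.
  by move=> w; apply: integral_ge0.
move=> A mA _; apply/esym; apply: product_measure_unique => //.
Qed.

End Independence.

Section PastSigmaAlgebra.
Variables (R : realType) (d n : nat).
Local Notation op := 'End('M[R]_(d, n)).
Variables (disp : measure_display) (T : measurableType disp).

(** The set [T] with only the events of the draws before [k]; the identity map into it is the random
    variable carrying the past. *)
Definition past_type (A B : nat -> T -> op) (k : nat) :=
  g_sigma_algebraType (\bigcup_(i in [set i | (i < k)%N]) pair_events (A i) (B i)).

Lemma pair_random_op (A B : T -> op) : random_op A -> random_op B ->
  measurable_fun [set: T] (fun w => (A w, B w) : opType R d n * opType R d n).
Proof. exact: measurable_fun_pair. Qed.

Variables (A B : nat -> T -> op) (k : nat).

Lemma past_type_random_op i : (i < k)%N ->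
  random_op (T := past_type A B k) (A i) /\ random_op (T := past_type A B k) (B i).
Proof.
move=> ik; split=> _ C mC; rewrite setTI; apply: sub_sigma_algebra; exists i => //.
  exists (C `*` setT); first exact: measurableX.
  by rewrite setTI; apply/seteqP; split=> w //= -[].
exists (setT `*` C); first exact: measurableX.
by rewrite setTI; apply/seteqP; split=> w //= -[].
Qed.

Hypotheses (A_random : forall i, random_op (A i)) (B_random : forall i, random_op (B i)).

Lemma measurable_to_past : measurable_fun [set: T] (fun w : T => w : past_type A B k).
Proof.
apply: (@measurability _ _ T (past_type A B k) setT _ _ erefl).
move=> _ [C [i _ [D mD <-]] <-]; rewrite !setTI preimage_id.
rewrite -[X in measurable X]setTI.
exact: (pair_random_op (A_random i) (B_random i)).
Qed.

End PastSigmaAlgebra.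

(** * From one step to all iterations *)

Theorem theorem5p1 (R : realType) (d n : nat) (hn : (0 < n)%N)
  (fs : 'I_n -> 'cV[R]_d -> R) (psi : 'cV[R]_d -> \bar R)
  (M : 'I_n -> 'M[R]_d) (sigma : R) (xs : 'cV[R]_d)
  (fs_diff : forall j x, differentiable (fs j) x)
  (fs_convex : forall j, convex_function [set: 'cV[R]_d] (fs j))
  (psi_proper : proper_fun psi)
  (psi_closed : lower_semicontinuous psi)
  (psi_convex : convex_efun psi)
  (xs_min : argmin (fun x => ((avg_fun fs x)%:E + psi x)%E) = [set xs])
  (sigma_gt0 : 0 < sigma)
  (f_qsc : quasi_strongly_convex (avg_fun fs) sigma xs)
  (M_psd : forall j, psd_mx (M j))
  (fs_smooth : forall j, smooth_wrt (fs j) (M j))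
  (disp0 : measure_display) (T0 : measurableType disp0) (P0 : probability T0 R)
  (S U : T0 -> 'End('M[R]_(d, n)))
  (S_random : random_op S) (U_random : random_op U)
  (S_proj : forall w, orth_proj (S w))
  (U_unbiased : unbiased P0 U)
  (disp : measure_display) (T : measurableType disp) (P : probability T R)
  (Sk Uk : nat -> T -> 'End('M[R]_(d, n)))
  (Sk_random : forall k, random_op (Sk k))
  (Uk_random : forall k, random_op (Uk k))
  (copies : forall k, same_law P P0 (Sk k) (Uk k) S U)
  (fresh : independent_of_past P Sk Uk)
  (alpha : R) (alpha_gt0 : 0 < alpha)
  (x0 : 'cV[R]_d) (J0 : 'M[R]_(d, n))
  (B Rop : 'End('M[R]_(d, n)))
  (B_comm : commutes_with P0 B S)
  (M_comm : commutes_with P0 (pinv_sqrt M) S)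
  (Rop_const : forall k, {ae P, forall w,
     Rop (gjs alpha psi fs x0 J0 (Sk ^~ w) (Uk ^~ w) k).2 = Rop (jac fs xs)})
  (cond1 : forall X : 'M[R]_(d, n), Rop X = 0 ->
     ((2 * alpha / n%:R ^+ 2)%:E * 'E_P0[fun w => sqnorm (U w X *m ones R n)]
      + (sqnorm (op_sqrt (\1%VF - op_mean P0 S) (B (pinv_sqrt M X))))%:E
      <= ((1 - alpha * sigma) * sqnorm (B (pinv_sqrt M X)))%:E)%E)
  (cond2 : forall X : 'M[R]_(d, n),
     ((2 * alpha / n%:R ^+ 2)%:E * 'E_P0[fun w => sqnorm (U w X *m ones R n)]
      + (sqnorm (op_sqrt (op_mean P0 S) (B (pinv_sqrt M X))))%:E
      <= (n%:R^-1 * sqnorm (pinv_sqrt M X))%:E)%E)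
  (k : nat) :
  ('E_P[fun w => lyapunov alpha B M xs (jac fs xs)
                   (gjs alpha psi fs x0 J0 (Sk ^~ w) (Uk ^~ w) k)]
   <= ((1 - alpha * sigma) ^+ k
        * lyapunov alpha B M xs (jac fs xs) (x0, J0))%:E)%E.
Proof.
pose z i w := gjs alpha psi fs x0 J0 (Sk ^~ w) (Uk ^~ w) i.
pose Psi zz := lyapunov alpha B M xs (jac fs xs) zz.
have xs_argmin : argmin (fun x => ((avg_fun fs x)%:E + psi x)%E) xs by rewrite xs_min.
have z_meas i : measurable_fun [set: T] (fun w => Psi (z i w)).
  have [mx mJ] := @gjs_measurable _ _ _ fs psi M alpha xs fs_convex psi_proper psi_closed
    psi_convex xs_argmin fs_smooth alpha_gt0 _ T x0 J0 Sk Uk i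
    (fun j _ => conj (Sk_random j) (Uk_random j)).
  exact: lyapunov_measurable.
have Psi_ge0 zz : 0 <= Psi zz by exact: lyapunov_ge0.
(* The mean after one step from a frozen state, computed with the generic pair under [P0]. *)
pose one_step zz := ('E_P0[fun w => Psi (gjs_step fs psi alpha zz (S w) (U w))])%E.
have one_step_ge0 zz : (0 <= one_step zz)%E.
  by apply: expectation_ge0 => w; exact: Psi_ge0.
have one_step_le i : {ae P, forall w,
    (one_step (z i w) <= ((1 - alpha * sigma) * Psi (z i w))%:E)%E}.
  apply: filterS (Rop_const i) => w.
  rewrite /one_step /Psi /z; case: (gjs _ _ _ _ _ _ _ _) => x J /= RJ.
  exact: gjs_step_expectation U_random S_proj U_unbiased B_comm M_comm
    cond1 cond2 _ _ RJ.
have step i : measurable_fun [set: T] (fun w => one_step (z i w)) /\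
    ('E_P[fun w => Psi (z i.+1 w)] = \int[P]_w one_step (z i w))%E.
  pose T1 := past_type Sk Uk i.
  pose T2 := (opType R d n * opType R d n)%type.
  pose Xmix := isMeasurableFun.Build _ _ T T1 _
    (@measurable_to_past _ _ _ _ _ Sk Uk i Sk_random Uk_random).
  pose X : {mfun T >-> T1} := HB.pack (fun w : T => w : T1) Xmix.
  pose Vmix := isMeasurableFun.Build _ _ T T2 _
    (pair_random_op (Sk_random i) (Uk_random i)).
  pose V : {mfun T >-> T2} := HB.pack (fun w : T => (Sk i w, Uk i w) : T2) Vmix.
  pose V0mix := isMeasurableFun.Build _ _ T0 T2 _ (pair_random_op S_random U_random).
  pose V0 : {mfun T0 >-> T2} := HB.pack (fun w : T0 => (S w, U w) : T2) V0mix.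
  (* [z i] depends on the past alone, so the next Lyapunov value is a function of the independent
     variables [X] and [V]. *)
  pose h (u : T1 * T2) := (Psi (gjs_step fs psi alpha (z i u.1) u.2.1 u.2.2))%:E.
  have h_ge0 u : (0 <= h u)%E by rewrite lee_fin.
  have mh : measurable_fun [set: T1 * T2] h.
    apply/measurable_EFinP.
    have past j (ji : (j < i)%N) := past_type_random_op Sk Uk ji.
    have [mx mJ] := @gjs_measurable _ _ _ fs psi M alpha xs fs_convex psi_proper
      psi_closed psi_convex xs_argmin fs_smooth alpha_gt0 _ (T1 * T2)%type x0 J0
      (fun j u => Sk j u.1) (fun j u => Uk j u.1) i
      (fun j ji => conj (measurableT_comp (past j ji).1 measurable_fst)
                        (measurableT_comp (past j ji).2 measurable_fst)).
    have mS : @random_op R d n _ (T1 * T2)%type (fun u => u.2.1).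
      exact: measurableT_comp measurable_fst measurable_snd.
    have mU : @random_op R d n _ (T1 * T2)%type (fun u => u.2.2).
      exact: measurableT_comp measurable_snd measurable_snd.
    have [msx msJ] := gjs_step_measurable fs_convex psi_proper psi_closed psi_convex
      xs_argmin fs_smooth alpha_gt0 mS mU mx mJ.
    exact: lyapunov_measurable.
  have indep (C : set T1) (D : set T2) : measurable C -> measurable D ->
      (P (X @^-1` C `&` V @^-1` D) = P (X @^-1` C) * P (V @^-1` D))%E.
    move=> mC mD; apply: (fresh i C (V @^-1` D) mC).
    by exists D => //; rewrite setTI.
  have inner w : (\int[distribution P V]_v h (X w, v) = one_step (z i w))%E.
    transitivity (\int[distribution P0 V0]_v h (X w, v))%E.
      by apply: eq_measure_integral => C mC _; exact: copies.
    rewrite ge0_integral_distribution; first last.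
    - by move=> v; exact: h_ge0.
    - by apply: measurableT_comp mh _; apply: pair1_measurable.
    by rewrite /one_step unlock.
  split.
    by have := measurable_section_integral P X V mh h_ge0; under eq_fun do rewrite inner.
  rewrite unlock -(eq_integral _ _ (fun w _ => inner w)) -independent_integral //.
  by apply: eq_integral => w _; rewrite /h /z gjsS.
have z0 : ('E_P[fun w => Psi (z 0%N w)] = (Psi (x0, J0))%:E)%E.
  exact: (has_mean_cst P (Psi (x0, J0))).2.
(* A nonnegative factor preserves the inequality in the induction; the other sign is settled
   separately. *)
have [c_ge0|c_lt0] := leP 0 (1 - alpha * sigma).
  elim: k => [|k IH]; first by rewrite expr0 mul1r [leLHS]z0.
  have [m_step ->] := step k.
  apply: (@le_trans _ _ (\int[P]_w ((1 - alpha * sigma)%:E * (Psi (z k w))%:E)))%E.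
    apply: ae_ge0_le_integral => //.
    - by move=> w _; rewrite -EFinM lee_fin mulr_ge0.
    - by apply: measurable_funeM; apply/measurable_EFinP.
    - by apply: filterS (one_step_le k) => w; rewrite EFinM.
  rewrite ge0_integralZl //; first last.
  - by move=> w _; rewrite lee_fin.
  - exact/measurable_EFinP.
  rewrite exprS -mulrA [leRHS]EFinM lee_wpmul2l ?lee_fin //.
  by move: IH; rewrite unlock.
(* With a negative factor, a nonnegative mean below its product with [Psi] forces [Psi] to vanish
   almost surely, also at the deterministic start; both sides are then 0. *)
have Psi0 i : {ae P, forall w, Psi (z i w) = 0}.
  apply: filterS (one_step_le i) => w /(le_trans (one_step_ge0 _)).
  rewrite lee_fin nmulr_rge0 // => Psi_le0; apply/eqP.
  by rewrite eq_le Psi_le0 Psi_ge0.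
have EPsi0 i : ('E_P[fun w => Psi (z i w)] = 0)%E.
  rewrite unlock (ae_eq_integral (cst 0%E)) ?integral0 //.
  - exact/measurable_EFinP.
  - by apply: filterS (Psi0 i) => w -> .
have Psi_x0 : Psi (x0, J0) = 0 by move: z0; rewrite EPsi0 => -[].
by rewrite [leLHS](EPsi0 k) -/(Psi (x0, J0)) Psi_x0 mulr0.
Qed.
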